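(* Let $Q\to+\infty$. Then for integers $r\geqslant 1$ with $r=o\bigl((Q/\ln Q)^{1/3}\bigr)$ the asymptotic formula $$\nu(Q;r,2,0)=\nu(r;2,0)+O\Bigl(\frac{\ln Q}{Q}\Bigr)$$ holds, where the implied constant is absolute, $\nu(r;2,0)=\lim_{Q\to+\infty}\nu(Q;r,2,0)$, and $$\nu(4;2,0)=\frac{2}{45},\qquad \nu(r;2,0)=\frac{8}{(2r-3)(2r-1)(2r+1)}\quad\text{for } r\geqslant 5.$$
   Context: For an integer $Q\geqslant 1$, the Farey sequence $\Phi_Q$ of order $Q$ is the set of irreducible fractions $a/q$ with $0\leqslant a\leqslant q\leqslant Q$, $\gcd(a,q)=1$, arranged in ascending order. It is extended periodically to the real line (all integer translates of its elements are included), and configurations differing by an integer translation are identified (so $0/1$ and $1/1$ count as one element, and one may normalise a tuple by requiring $0<a_0/q_0\leqslant 1$). For integers $D\geqslant 2$, $0\leqslant c_0\leqslant D-1$, $r\geqslant 1$: $N(Q;D,c_0)$ is the number of elements $a/q$ of $\Phi_Q$ with $q\equiv c_0\pmod D$; $N(Q;r,D,c_0)$ is the number of $(r+2)$-tuples of consecutive fractions $$\frac{a_0}{q_0}<\frac{a_1}{q_1}<\dots<\frac{a_r}{q_r}<\frac{a_{r+1}}{q_{r+1}}$$ of the extended sequence such that $q_0\equiv q_{r+1}\equiv c_0\pmod D$ and $q_i\not\equiv c_0\pmod D$ for $i=1,\dots,r$. Finally $$\nu(Q;r,D,c_0)=\frac{N(Q;r,D,c_0)}{N(Q;D,c_0)},\qquad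 \nu(r;D,c_0)=\lim_{Q\to+\infty}\nu(Q;r,D,c_0).$$ *)

(* Defs.v *)
From HB Require Import structures.
From mathcomp Require Import all_boot all_order all_algebra finmap.
From mathcomp Require Import all_classical all_reals all_analysis.

Set Implicit Arguments.
Unset Strict Implicit.
Unset Printing Implicit Defensive.

Import Order.TTheory GRing.Theory Num.Theory.
Import numFieldNormedType.Exports.

Local Open Scope classical_set_scope.
Local Open Scope ring_scope.

Definition farey (Q : nat) : set rat :=
  [set x | exists a q : nat,
     [/\ (0 < q)%N, (a <= q <= Q)%N, coprime a q & x = a%:R / q%:R]].

Definition farey_ext (Q : nat) : set rat :=
  [set x | exists2 y, farey Q y & exists n : int, x = y + n%:~R].

(* [denq] is [int]-valued but always positive. *)
Definition den (x : rat) : nat := `|denq x|%N.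

Definition farey_next (Q : nat) (x y : rat) : Prop :=
  [/\ farey_ext Q x, farey_ext Q y, x < y &
      forall z, farey_ext Q z -> ~ (x < z < y)].

(* The condition 0 < x <= 1, here and for the first entry of a tuple below,
   selects one representative of each class modulo integer translations. *)
Definition farey_class (Q D c0 : nat) : set rat :=
  [set x | [/\ farey_ext Q x, 0 < x <= 1 & den x = c0 %[mod D]]].

Definition farey_tuples (Q r D c0 : nat) : set (r.+2.-tuple rat) :=
  [set t | [/\ 0 < t`_0 <= 1,
     (forall i, (i <= r)%N -> farey_next Q t`_i t`_i.+1),
     den t`_0 = c0 %[mod D],
     den t`_r.+1 = c0 %[mod D] &
     forall i, (1 <= i <= r)%N -> den t`_i <> c0 %[mod D]]].
Arguments farey_tuples : clear implicits.

(* [fset_set] sends infinite sets to the empty set; the sets it is applied to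
   are finite by [finite_farey_class] and [finite_farey_tuples] below. *)
Definition N_class (Q D c0 : nat) : nat := #|` fset_set (farey_class Q D c0)|.

Definition N_tuples (Q r D c0 : nat) : nat :=
  #|` fset_set (farey_tuples Q r D c0)|.

(* This is 0 when no denominator up to Q is congruent to c0, since x / 0 = 0. *)
Definition nuQ (R : realType) (Q r D c0 : nat) : R :=
  (N_tuples Q r D c0)%:R / (N_class Q D c0)%:R.

Definition nu (R : realType) (r D c0 : nat) : R :=
  lim (nuQ R Q r D c0 @[Q --> \oo]).

Lemma finite_farey (Q : nat) : finite_set (farey Q).
Proof.
apply: (@sub_finite_set _ _
  ((fun p : nat * nat => p.1%:R / p.2%:R : rat) @` (`I_Q.+1 `*` `I_Q.+1))).
  move=> x [a [q [_ /andP[aq qQ] _ ->]]]; exists (a, q) => //=.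
  by split => /=; rewrite ltnS // (leq_trans aq).
by apply/finite_image/finite_setX; exact: finite_II.
Qed.

Lemma farey_ext_itv (Q : nat) (x : rat) :
  farey_ext Q x -> 0 < x <= 1 -> farey Q x.
Proof.
move=> [y Fy [n xE]] /andP[x0 x1].
have [a [q [q0 /andP[aq qQ] cop yE]]] := Fy.
have q0' : (0 : rat) < q%:R by rewrite ltr0n.
have y0 : 0 <= y by rewrite yE divr_ge0 // ler0n.
have y1 : y <= 1 by rewrite yE ler_pdivrMr // mul1r ler_nat.
have nle : (n <= 1)%R.
  by rewrite -(ler_int rat) -(lerD2l y) -xE (le_trans x1)// lerDr.
have nge : (-1 < n)%R.
  rewrite -(ltr_int rat) -(ltrD2l y) -xE (le_lt_trans _ x0)//.
  by rewrite mulrN1z subr_le0.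
have [n0|n1] : n = 0 \/ n = 1 by case: n nle nge {xE} => [[|[|?]]|?]; auto.
- by rewrite xE n0 addr0.
- have x1' : x = 1 by apply/eqP; rewrite eq_le x1 /= xE n1 lerDr.
  by exists 1%N, 1%N; split; rewrite ?x1' ?divr1 //= (leq_trans q0 qQ).
Qed.

Lemma finite_farey_class (Q D c0 : nat) : finite_set (farey_class Q D c0).
Proof.
apply: (sub_finite_set _ (finite_farey Q)) => x [Fx x01 _].
exact: farey_ext_itv.
Qed.

Lemma finite_farey_tuples (Q r D c0 : nat) :
  finite_set (farey_tuples Q r D c0).
Proof.
have next_inj x y z : farey_next Q x y -> farey_next Q x z -> y = z.
  move=> [_ Fy xy hy] [_ Fz xz hz]; apply/eqP; case: ltgtP => // h; exfalso.
  - by apply: (hz _ Fy); rewrite xy h.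
  - by apply: (hy _ Fz); rewrite xz h.
pose f (t : r.+2.-tuple rat) := t`_0.
have f_inj : {in farey_tuples Q r D c0 &, injective f}.
  move=> s t; rewrite !inE => -[_ hs _ _ _] [_ ht _ _ _] st0.
  apply: val_inj; apply: (@eq_from_nth _ 0); rewrite !size_tuple // => i.
  elim: i => [//|i IH] ir.
  have {}IH : s`_i = t`_i by apply: IH; exact: ltnW.
  by apply: (next_inj s`_i); [exact: hs|rewrite IH; exact: ht].
rewrite -(eq_finite_set (inj_card_eq f_inj)).
apply: (sub_finite_set _ (finite_farey Q)) => x [t [t01 ht _ _ _] <-].
by apply: farey_ext_itv => //; have [] := ht 0%N isT.
Qed.

(* Main.v *)
Require Import Defs.
From mathcomp Require Import all_boot all_order all_algebra finmap.
From mathcomp Require Import all_classical all_reals all_analysis.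
From mathcomp Require Import zify ring lra.
Set Implicit Arguments.
Unset Strict Implicit.
Unset Printing Implicit Defensive.
Import Order.TTheory GRing.Theory Num.Theory.
Import numFieldNormedType.Exports.

(** Two reduced fractions are consecutive in the Farey sequence of order Q
    exactly when they have determinant 1 and their denominators a, b <= Q
    satisfy a + b > Q; the denominator that follows a, b is then the c in
    (Q - b, Q] with b | a + c. Hence fractions correspond to the coprime points
    of a triangle ([dens_tri], [dens_surj], [dens_inj]), on which the passage to
    the next fraction is a permutation, and a tuple counted by the theorem is a
    point whose orbit has the parities E O^r E (E even, O odd). Write V_r for
    the number of points whose orbit starts with r odd entries. Since E O^r is
    O^r not preceded by O, the number of orbits E O^r is V_r - V_{r+1}, and the
    number of orbits E O^r E is V_r - 2 V_{r+1} + V_{r+2} ([count_EOE]).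

    Coprimality is removed by Moebius inversion: the points of order Q divisible
    by an odd e are e times the points of order Q / e, with the same parities, so
    the coprime count of order Q is the sum of mobius e * V_r(Q / e) over odd e,
    where V_r now counts all points. It therefore suffices to know
    V_r(X) = v_r X^2/8 + O(X) uniformly in r; the errors O(Q / e) add up to O(Q ln Q), while the number of fractions
    with even denominator, V_1 - V_2 in coprime counts, is at least a constant
    times Q^2. As v_1 - v_2 = 1, nu(r) is the second difference
    v_r - 2 v_{r+1} + v_{r+2}, and the rate is uniform in all r >= 1.

    For r >= 5 (and r = 2) a run of odd denominators is an arithmetic progression
    ([oddrun_AP]): for odd neighbours a, b, c the quotient (a + c) / b is even,
    and the value 4 or more in a run of length five contradicts the inequalities
    defining the triangle. Progressions are the lattice points of two triangles,
    which gives v_r = 1/(2r-3), with second difference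
    8/((2r-3)(2r-1)(2r+1)). For r = 4 there are in addition the runs
    3x-d, x, x+d, x+2d and their reversals, contributing 2/105 to v_4.

    For r = 3 the value of v_3 does not matter, but an error O(X) without a
    logarithm does. Up to O(X), V_3(X) is the sum of the distances from X to the
    multiples of the odd q <= X. This distance is a piecewise linear function of
    q, so replacing X by n X multiplies the sum by n^2 exactly, except near the
    breakpoints 2X/j, whose total contribution is O(n^2 X) ([dsum_scale]); thus
    the sum divided by X^2 is a Cauchy sequence with rate O(1/X)
    ([dsum_asymp]). *)

Local Open Scope classical_set_scope.
Local Open Scope ring_scope.
Local Open Scope nat_scope.

(** * Pairs of neighbouring denominators *)

(** Pairs with a common divisor are kept: they are what makes the counts below
    counts of all lattice points of a region. *)
Definition tri (X : nat) : seq (nat * nat) :=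
  [seq p <- [seq (a, b) | a <- iota 1 X, b <- iota 1 X] | X < p.1 + p.2].

Lemma mem_tri X a b :
  ((a, b) \in tri X) = [&& 0 < a <= X, 0 < b <= X & X < a + b].
Proof.
rewrite mem_filter /= andbC andbA; congr (_ && _).
apply/allpairsP/andP => [[[x y] /= []]|[aX bX]].
  by rewrite !mem_iota !add1n !ltnS => xX yX [-> ->].
by exists (a, b); rewrite /= !mem_iota !add1n !ltnS; split.
Qed.

Lemma mem_triP X a b : (a, b) \in tri X -> [/\ 0 < a, a <= X, 0 < b, b <= X & X < a + b].
Proof. by rewrite mem_tri => /and3P[/andP[? ?] /andP[? ?] ?]. Qed.

Lemma tri_uniq X : uniq (tri X).
Proof.
by apply/filter_uniq/allpairs_uniq; rewrite ?iota_uniq // => -[a b] [c d].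
Qed.

(** The denominator that follows the neighbours [a], [b] in the Farey sequence
    of order [X]: the number in the window (X - b, X] that is congruent to
    [- a] modulo [b]. *)
Definition nxt (X a b : nat) : nat := X - (X + a) %% b.

Lemma nxtP X a b : (a, b) \in tri X ->
  (b, nxt X a b) \in tri X /\ b %| a + nxt X a b.
Proof.
rewrite !mem_tri /nxt => /and3P[aX /andP[b0 bX] ab].
have rb : (X + a) %% b < b by rewrite ltn_mod.
split; first by lia.
apply/dvdnP; exists ((X + a) %/ b).
by have := divn_eq (X + a) b; lia.
Qed.

Lemma nxt_eq X a b c : (a, b) \in tri X -> (b, c) \in tri X -> b %| a + c ->
  nxt X a b = c.
Proof.
move=> abT bcT bac; have [bnT ban] := nxtP abT.
set n := nxt X a b in bnT ban *.
move: bcT bnT; rewrite !mem_tri => bcT bnT.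
wlog nc : n c ban bac bcT bnT / n <= c.
  by move=> th; case: (leqP n c) => ?; [exact: th|apply/esym/th => //; lia].
have : b %| c - n.
  by rewrite -(dvdn_addr _ ban) (_ : a + n + (c - n) = a + c) //; lia.
case: (posnP (c - n)) => [|cn0 /(dvdn_leq cn0)]; lia.
Qed.

Definition step X (p : nat * nat) : nat * nat := (p.2, nxt X p.1 p.2).

Lemma step_tri X p : p \in tri X -> step X p \in tri X.
Proof. by case: p => a b /nxtP[]. Qed.

(** The relation [b %| a + c] between three consecutive denominators is
    symmetric, so walking backwards follows the same rule. *)
Lemma step_swapK X p : p \in tri X ->
  let sw (q : nat * nat) := (q.2, q.1) in step X (sw (step X (sw p))) = p.
Proof.
case: p => a b abT /=; rewrite /step /=.
have baT : (b, a) \in tri X by move: abT; rewrite !mem_tri; lia.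
have [nT dn] := nxtP baT.
congr (_, _); apply: nxt_eq; rewrite // 1?addnC //.
by move: nT; rewrite !mem_tri; lia.
Qed.

Lemma swap_tri X a b : ((b, a) \in tri X) = ((a, b) \in tri X).
Proof. by rewrite !mem_tri; lia. Qed.

Lemma count_bij (T T' : eqType) (s : seq T) (s' : seq T') (P : pred T)
    (P' : pred T') (f : T -> T') : uniq s -> uniq s' ->
  (forall x, x \in s -> P x -> f x \in s' /\ P' (f x)) ->
  (forall x y, x \in s -> y \in s -> P x -> P y -> f x = f y -> x = y) ->
  (forall y, y \in s' -> P' y -> exists2 x, x \in s /\ P x & y = f x) ->
  count P s = count P' s'.
Proof.
move=> us us' fs fI fS; rewrite -!size_filter -(size_map f).
apply/perm_size/uniq_perm; rewrite ?filter_uniq //.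
  rewrite map_inj_in_uniq ?filter_uniq // => x y.
  by rewrite !mem_filter => /andP[Px xs] /andP[Py ys]; exact: fI.
move=> y; rewrite mem_filter; apply/mapP/andP => [[x]|[P'y ys']].
  by rewrite mem_filter => /andP[Px xs] ->; have [] := fs x xs Px.
by have [x [xs Px] ->] := fS y ys' P'y; exists x; rewrite ?mem_filter ?Px.
Qed.

(** [step] permutes the pairs, by [step_swapK]. *)
Lemma count_step X (P : pred (nat * nat)) :
  count (fun p => P (step X p)) (tri X) = count P (tri X).
Proof.
apply: (count_bij (f := step X)); rewrite ?tri_uniq //.
- by move=> p pT Pp; rewrite step_tri.
- move=> [a b] [c d] abT cdT _ _ [bd nn]; subst d.
  have := @step_swapK X (b, a); have := @step_swapK X (b, c).
  rewrite /step /= swap_tri => /(_ cdT) h1; rewrite swap_tri => /(_ abT) h2.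
  by move: h2; rewrite nn h1 => -[->].
- move=> [a b] abT Pp; have /= qE := step_swapK abT.
  exists (nxt X b a, a) => //; split; last by rewrite qE.
  by rewrite swap_tri; apply: (@step_tri X (b, a)); rewrite swap_tri.
Qed.

(** ** Homogeneity *)

Lemma tri_scale e X a b : 0 < e ->
  ((e * a, e * b) \in tri X) = ((a, b) \in tri (X %/ e)).
Proof.
move=> e0; rewrite !mem_tri !muln_gt0 e0 /= !leq_divRL // -mulnDr ltn_divLR //.
by rewrite ![_ * e]mulnC.
Qed.

(** The rule for the next denominator commutes with multiplication by [e],
    since its characterisation [nxt_eq] is homogeneous. *)
Lemma nxt_scale e X a b : 0 < e -> (a, b) \in tri (X %/ e) ->
  nxt X (e * a) (e * b) = e * nxt (X %/ e) a b.
Proof.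
move=> e0 abT; have [bnT abn] := nxtP abT.
by apply: nxt_eq; rewrite ?tri_scale // -mulnDr dvdn_pmul2l.
Qed.

(** ** Runs of odd denominators *)

Definition orb X p i := (iter i (step X) p).1.

Lemma orbS X p i : orb X p i.+1 = orb X (step X p) i.
Proof. by rewrite /orb iterSr. Qed.

Definition oddrun X r p := all (fun i => odd (orb X p i)) (iota 0 r).

Lemma oddrunS X r p : oddrun X r.+1 p = odd p.1 && oddrun X r (step X p).
Proof.
rewrite /oddrun /= (iotaDl 1 0) all_map; congr (_ && _).
by apply: eq_all => i /=; rewrite add1n orbS.
Qed.

Lemma oddrunSr X r p : oddrun X r.+1 p = oddrun X r p && odd (orb X p r).
Proof. by rewrite /oddrun -addn1 iotaD all_cat /= andbT. Qed.

Lemma iter_step_scale e X p i : 0 < e -> p \in tri (X %/ e) ->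
  iter i (step X) (e * p.1, e * p.2) =
    (e * (iter i (step (X %/ e)) p).1, e * (iter i (step (X %/ e)) p).2) /\
  iter i (step (X %/ e)) p \in tri (X %/ e).
Proof.
move=> e0 pT; elim: i => [|i [IH T]] //=.
rewrite IH step_tri //; split=> //.
by rewrite /step /= nxt_scale //; case: (iter _ _ _) T.
Qed.

Lemma oddrun_scale e X r p : odd e -> p \in tri (X %/ e) ->
  oddrun X r (e * p.1, e * p.2) = oddrun (X %/ e) r p.
Proof.
move=> oe pT; apply: eq_all => i.
by rewrite /orb; have [-> _] := iter_step_scale i (odd_gt0 oe) pT; rewrite oddM oe.
Qed.

Definition oddruns X r := count (oddrun X r) (tri X).
Definition coprime_oddruns X r :=
  count (fun p => coprime p.1 p.2 && oddrun X r p) (tri X).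

(** An odd factor does not change parities, so the pairs divisible by [e] are a
    copy of the pairs of order [X %/ e]. *)
Lemma oddruns_scale e X r : 0 < r -> odd e ->
  count (fun p => [&& e %| p.1, e %| p.2 & oddrun X r p]) (tri X) = oddruns (X %/ e) r.
Proof.
move=> r0 oe; have e0 := odd_gt0 oe; apply/esym.
apply: (count_bij (f := fun p => (e * p.1, e * p.2))); rewrite ?tri_uniq //.
- move=> [a b] abT /= od; rewrite tri_scale // abT; split=> //.
  by rewrite !dvdn_mulr //= (oddrun_scale _ oe abT).
- move=> [a b] [c d] _ _ _ _ [] /eqP + /eqP.
  by rewrite !eqn_pmul2l // => /eqP-> /eqP->.
- move=> [a b] abT /= /and3P[/dvdnP[a' aE] /dvdnP[b' bE]].
  rewrite {}aE {}bE ![_ * e]mulnC in abT * => od.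
  have abT' : (a', b') \in tri (X %/ e) by rewrite -tri_scale.
  by exists (a', b') => //; rewrite -(oddrun_scale r oe abT').
Qed.

Lemma oddruns_scale_even e X r : 0 < r -> 0 < e -> ~~ odd e ->
  count (fun p => [&& e %| p.1, e %| p.2 & oddrun X r p]) (tri X) = 0.
Proof.
case: r => // r _ _ oe; apply/eqP; rewrite -leqn0 leqNgt -has_count -all_predC.
apply/allP => p _ /=; rewrite oddrunS; case: (boolP (odd p.1)) => [op|]; last first.
  by rewrite !andbF.
by case: (boolP (e %| p.1)) => // /dvdnP[k kE]; move: op; rewrite kE oddM (negbTE oe) andbF.
Qed.

Lemma coprime_step X p : p \in tri X ->
  coprime (step X p).1 (step X p).2 = coprime p.1 p.2.
Proof.
case: p => a b /nxtP[_ /= bac]; rewrite /coprime; congr (_ == _).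
apply/eqP; rewrite eqn_dvd !dvdn_gcd dvdn_gcdl dvdn_gcdr /=.
have gb := dvdn_gcdl b (nxt X a b); have gb' := dvdn_gcdr a b.
rewrite -(dvdn_addl _ (dvdn_gcdr b (nxt X a b))) (dvdn_trans gb bac) /=.
by rewrite -(dvdn_addr _ (dvdn_gcdl a b)) (dvdn_trans gb' bac).
Qed.

Definition E_oddrun X r p := ~~ odd p.1 && oddrun X r (step X p).

Definition even_gaps (Q r : nat) : nat :=
  count (fun p => [&& coprime p.1 p.2, E_oddrun Q r p & ~~ odd (orb Q p r.+1)])
    (tri Q).

Definition even_pairs (Q : nat) : nat :=
  count (fun p => coprime p.1 p.2 && E_oddrun Q 1 p) (tri Q).

(** Because [step] permutes the pairs, [coprime_oddruns X r] also counts the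
    pairs whose second entry starts [r] odd denominators; the first entry is
    odd for [coprime_oddruns X r.+1] of them and even for the others. *)
Lemma count_E_oddrun X r :
  count (fun p => coprime p.1 p.2 && E_oddrun X r p) (tri X) =
    coprime_oddruns X r - coprime_oddruns X r.+1 /\
  coprime_oddruns X r.+1 <= coprime_oddruns X r.
Proof.
suff <- : count (fun p => coprime p.1 p.2 && E_oddrun X r p) (tri X) +
  coprime_oddruns X r.+1 = coprime_oddruns X r by rewrite addnK leq_addl.
rewrite /coprime_oddruns -[RHS]count_step -count_predUI addnC.
rewrite [X in X + _ = _](_ : _ = 0) ?add0n.
  apply: eq_in_count => p pT /=; rewrite coprime_step // /E_oddrun oddrunS.
  by case: (coprime _ _); case: (odd _); rewrite /= ?orbF.
apply/eqP; rewrite -leqn0 leqNgt -has_count -all_predC; apply/allP => p _ /=.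
by rewrite /E_oddrun oddrunS; case: (odd _); rewrite /= ?andbF.
Qed.

(** The patterns E O^r E are the patterns E O^r that do not extend to
    E O^(r+1); so their number is a second difference of [coprime_oddruns]. *)
Lemma count_EOE X r :
  even_gaps X r + coprime_oddruns X r.+1 + coprime_oddruns X r.+1 =
  coprime_oddruns X r + coprime_oddruns X r.+2.
Proof.
rewrite /even_gaps.
have [e1 l1] := count_E_oddrun X r; have [e2 l2] := count_E_oddrun X r.+1.
suff : count (fun p => [&& coprime p.1 p.2, E_oddrun X r p & ~~ odd (orb X p r.+1)])
    (tri X) + count (fun p => coprime p.1 p.2 && E_oddrun X r.+1 p) (tri X) =
    count (fun p => coprime p.1 p.2 && E_oddrun X r p) (tri X) by lia.
rewrite -count_predUI addnC [X in X + _ = _](_ : _ = 0) ?add0n.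
  apply: eq_count => p /=; rewrite /E_oddrun oddrunSr orbS.
  by case: (coprime _ _); case: (odd p.1); case: (oddrun _ _ _); case: (odd _).
apply/eqP; rewrite -leqn0 leqNgt -has_count -all_predC; apply/allP => p _ /=.
rewrite /E_oddrun oddrunSr orbS.
by case: (odd (orb _ _ _)); rewrite /= ?andbF.
Qed.

Local Open Scope classical_set_scope.
Local Open Scope ring_scope.

(** * From Farey fractions to pairs of denominators *)

Lemma denqE x : denq x = (den x)%:Z.
Proof. by rewrite /den gez0_abs // ltW. Qed.

Lemma den_gt0 x : (0 < den x)%N.
Proof. by rewrite -ltz_nat -denqE. Qed.

Lemma ratE x : x = (numq x)%:~R / (den x)%:R.
Proof. by rewrite -{1}(divq_num_den x) denqE. Qed.

Lemma frac_num_den (b : int) (c : nat) : (0 < c)%N -> coprime `|b| c ->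
  numq (b%:~R / c%:R) = b /\ den (b%:~R / c%:R) = c.
Proof.
move=> c0 bc; have -> : (c%:R : rat) = (c%:Z)%:~R by [].
split; first by rewrite coprimeq_num // gtr0_sg ?mul1r.
by rewrite /den coprimeq_den //=; case: c c0 {bc}.
Qed.

Definition det (x y : rat) : int := numq y * (den x)%:Z - numq x * (den y)%:Z.

Lemma det_gt0 x y : (x < y) = (0 < det x y).
Proof.
rewrite {1}(ratE x) {1}(ratE y) ltr_pdivrMr ?ltr0n ?den_gt0 //.
rewrite mulrAC ltr_pdivlMr ?ltr0n ?den_gt0 // subr_gt0.
by rewrite -(ltr_int rat) !rmorphM.
Qed.

Lemma coprime_numq_den x : coprime `|numq x| (den x).
Proof. exact: coprime_num_den. Qed.

Lemma coprime_lin (b u v : int) (c : nat) :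
  u * b + v * c%:Z = 1 -> coprime `|b| c.
Proof. by move=> e; rewrite -[c]/`|c%:Z|%N -coprimezE; apply/coprimezP; exists (u, v). Qed.

Lemma farey_extE Q x : farey_ext Q x <-> (den x <= Q)%N.
Proof.
split.
  move=> [_ [a [q [q0 /andP[_ qQ] cop ->]]] [n ->]].
  have -> : (a%:R / q%:R + n%:~R : rat) = (a%:Z + n * q%:Z)%:~R / q%:R.
    rewrite rmorphD rmorphM /=; field; by rewrite pnatr_eq0 -lt0n.
  have [] := @frac_num_den (a%:Z + n * q%:Z) q q0; last by move=> _ ->.
  have : coprimez a%:Z q%:Z by rewrite coprimezE.
  move=> /coprimezP[[u v] /= uv].
  by apply: (@coprime_lin _ u (v - u * n)); rewrite -uv; ring.
move=> xQ; have d0 := den_gt0 x.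
have dn0 : (den x)%:Z != 0 by rewrite eqz_nat -lt0n.
pose a := `|(numq x %% (den x)%:Z)%Z|%N.
have aE : a%:Z = (numq x %% (den x)%:Z)%Z by rewrite gez0_abs ?modz_ge0.
have xE := divz_eq (numq x) (den x)%:Z; rewrite -aE in xE.
exists (a%:R / (den x)%:R); last first.
  exists (numq x %/ (den x)%:Z)%Z; rewrite {1}(ratE x) {1}xE rmorphD rmorphM /=.
  by field; rewrite pnatr_eq0 -lt0n.
exists a, (den x); split=> //.
  by rewrite xQ andbT -lez_nat aE ltW // ltz_pmod.
have : coprimez (numq x) (den x)%:Z by rewrite coprimezE coprime_numq_den.
move=> /coprimezP[[u v] /= uv].
by apply: (@coprime_lin a%:Z u (v + u * (numq x %/ (den x)%:Z)%Z)); rewrite -uv {2}xE; ring.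
Qed.

(** When det x y = 1, a fraction z between x and y has denominator
    den x * det z y + den y * det x z, which is at least den x + den y. *)
Lemma adjacent_next Q x y : (den x <= Q)%N -> (den y <= Q)%N ->
  det x y = 1 -> (Q < den x + den y)%N -> farey_next Q x y.
Proof.
move=> xQ yQ dxy sQ; split; rewrite ?farey_extE // ?det_gt0 ?dxy // => z.
move/farey_extE => zQ; rewrite !det_gt0 => /andP[xz zy].
have zE : (den z)%:Z = (den x)%:Z * det z y + (den y)%:Z * det x z.
  rewrite -[LHS]mulr1 -dxy /det; ring.
have h1 : (den x)%:Z <= (den x)%:Z * det z y by rewrite ler_peMr.
have h2 : (den y)%:Z <= (den y)%:Z * det x z by rewrite ler_peMr.
by lia.
Qed.

(** A Bezout relation for x gives some y with det x y = 1; adding multiples of x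
    to its numerator and denominator moves the denominator into
    (Q - den x, Q]. *)
Lemma adjacent_ex Q x : (den x <= Q)%N -> exists y,
  [/\ (den y <= Q)%N, det x y = 1 & (Q < den x + den y)%N].
Proof.
move=> xQ; have d0 := den_gt0 x.
have : coprimez (numq x) (den x)%:Z by rewrite coprimezE coprime_numq_den.
move=> /coprimezP[[u v] /= uv].
have dn0 : (den x)%:Z != 0 by rewrite eqz_nat -lt0n.
pose k := ((Q%:Z + u) %/ (den x)%:Z)%Z; pose m := ((Q%:Z + u) %% (den x)%:Z)%Z.
have kE : Q%:Z + u = k * (den x)%:Z + m by exact: divz_eq.
have m0 : 0 <= m by rewrite modz_ge0.
have md : m < (den x)%:Z by rewrite ltz_pmod.
pose c := absz (- u + k * (den x)%:Z).
have cE : c%:Z = - u + k * (den x)%:Z by rewrite /c gez0_abs //; lia.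
pose b := v + k * numq x.
have dbc : b * (den x)%:Z - numq x * c%:Z = 1 by rewrite cE /b -uv; ring.
have [||nE dE] := @frac_num_den b c; first by lia.
  by apply: (@coprime_lin _ (den x)%:Z (- numq x)); rewrite -dbc; ring.
by exists (b%:~R / c%:R); rewrite /det nE dE; split; lia.
Qed.

Lemma farey_next_inj Q x y z : farey_next Q x y -> farey_next Q x z -> y = z.
Proof.
move=> [_ Fy xy hy] [_ Fz xz hz]; apply/eqP; case: ltgtP => // h; exfalso.
- by apply: (hz _ Fy); rewrite xy h.
- by apply: (hy _ Fz); rewrite xz h.
Qed.

(** The conditions of [adjacent_next] are also necessary: [adjacent_ex] provides
    a successor that satisfies them, and the successor is unique. *)
Lemma farey_nextP Q x y : farey_next Q x y ->
  [/\ (den x <= Q)%N, (den y <= Q)%N, det x y = 1 & (Q < den x + den y)%N].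
Proof.
move=> xy; have xQ : (den x <= Q)%N by case: xy => /farey_extE.
have [z [zQ xz sQ]] := adjacent_ex xQ.
by rewrite (farey_next_inj xy (adjacent_next xQ zQ xz sQ)).
Qed.

Definition nextf (Q : nat) (x : rat) : rat := xget 0 [set y | farey_next Q x y].

Lemma nextfP Q x : (den x <= Q)%N -> farey_next Q x (nextf Q x).
Proof.
move=> xQ; have [z [zQ xz sQ]] := adjacent_ex xQ.
exact: (@xgetI _ 0 [set y | farey_next Q x y] z (adjacent_next xQ zQ xz sQ)).
Qed.

Definition dens (Q : nat) (x : rat) : nat * nat := (den x, den (nextf Q x)).

Lemma dens_tri Q x : (den x <= Q)%N ->
  dens Q x \in tri Q /\ coprime (dens Q x).1 (dens Q x).2.
Proof.
move=> xQ; have [_ yQ d s] := farey_nextP (nextfP xQ).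
split; first by rewrite mem_tri !den_gt0 xQ yQ.
apply: (@coprime_lin (den x)%:Z (numq (nextf Q x)) (- numq x)).
by rewrite -d /det; ring.
Qed.

(** Subtracting the two determinant relations around y = [nextf Q x] eliminates
    all numerators but that of y, and leaves den y | den x + den z. *)
Lemma dens_next Q x : (den x <= Q)%N -> dens Q (nextf Q x) = step Q (dens Q x).
Proof.
move=> xQ; have [_ yQ d s] := farey_nextP (nextfP xQ).
have [_ zQ d' s'] := farey_nextP (nextfP yQ).
set y := nextf Q x in yQ d s d' zQ s' *; set z := nextf Q y in d' zQ s' *.
rewrite /dens /step -/y -/z; congr (_, _); apply/esym/nxt_eq.
- by rewrite mem_tri !den_gt0 xQ yQ.
- by rewrite mem_tri !den_gt0 yQ zQ.
have : ((den y)%:Z %| (den x + den z)%:Z)%Z.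
  rewrite -(@Gauss_dvdzr _ (numq y)); last first.
    by rewrite coprimez_sym coprimezE coprime_numq_den.
  apply/dvdzP; exists (numq x + numq z); rewrite PoszD mulrDr.
  by move: d d'; rewrite /det; lia.
by rewrite dvdzE.
Qed.

Lemma dens_iter Q x i : (den x <= Q)%N ->
  (den (iter i (nextf Q) x) <= Q)%N /\
  dens Q (iter i (nextf Q) x) = iter i (step Q) (dens Q x).
Proof.
move=> xQ; elim: i => [//|i [IHQ IH]] /=; rewrite dens_next // IH; split=> //.
by have [] := farey_nextP (nextfP IHQ).
Qed.

Lemma den_iter Q x i : (den x <= Q)%N ->
  den (iter i (nextf Q) x) = orb Q (dens Q x) i.
Proof. by move=> /(dens_iter i)[_ e]; rewrite /orb -e. Qed.

(** The denominators of x and of its successor determine the numerator of x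
    modulo den x. *)
Lemma dens_inj Q x x' : (den x <= Q)%N -> (den x' <= Q)%N ->
  0 < x <= 1 -> 0 < x' <= 1 -> dens Q x = dens Q x' -> x = x'.
Proof.
move=> xQ xQ' x01 xx01 [e1 e2].
have [_ yQ d s] := farey_nextP (nextfP xQ).
have [_ zQ d' s'] := farey_nextP (nextfP xQ').
have [_ /= cop] := dens_tri xQ.
have num_itv t : 0 < t <= 1 -> 0 < numq t <= (den t)%:Z.
  move=> /andP[t0 t1]; rewrite numq_gt0 t0 /= -(ler_int rat).
  have : t * (den t)%:R <= (den t)%:R by rewrite ler_piMl ?ler0n.
  by rewrite {1}(ratE t) divfK // pnatr_eq0 -lt0n den_gt0.
suff nE : numq x = numq x' by rewrite (ratE x) (ratE x') nE -e1.
have h1 := num_itv x x01; have h2 := num_itv x' xx01; rewrite -e1 in h2.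
suff /dvdzP[k kE] : ((den x)%:Z %| numq x - numq x')%Z.
  have d0 := den_gt0 x; have k0 : k = 0 by nia.
  by move: kE; rewrite k0 mul0r => /eqP; rewrite subr_eq0 => /eqP.
rewrite -(@Gauss_dvdzl _ _ (den (nextf Q x))%:Z) ?coprimezE //.
apply/dvdzP; exists (numq (nextf Q x) - numq (nextf Q x')).
by move: d d'; rewrite /det -e1 -e2; lia.
Qed.

Lemma dens_surj Q p : p \in tri Q -> coprime p.1 p.2 ->
  exists x, [/\ (den x <= Q)%N, 0 < x <= 1 & dens Q x = p].
Proof.
case: p => a b abT /= cop; have [a0 aQ b0 bQ sQ] := mem_triP abT.
have : coprimez a%:Z b%:Z by rewrite coprimezE.
move=> /coprimezP[[u v] /= uv].
(* the representative in (0, a] of the solutions c of c * b = -1 mod a *)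
have a0' : a%:Z != 0 by rewrite eqz_nat -lt0n.
pose m := ((v) %% a%:Z)%Z; pose k := ((v) %/ a%:Z)%Z.
have kE : v = k * a%:Z + m by exact: divz_eq.
have m0 : 0 <= m by rewrite modz_ge0.
have ma : m < a%:Z by rewrite ltz_pmod.
pose c := a%:Z - m; pose s := b%:Z + u + k * b%:Z.
have det1 : s * a%:Z - c * b%:Z = 1 by rewrite -uv {1}kE /s /c; ring.
have [//||nx dx] := @frac_num_den c a.
  by apply: (@coprime_lin _ (- b%:Z) s); rewrite -det1; ring.
have [//||ny dy] := @frac_num_den s b.
  by apply: (@coprime_lin _ a%:Z (- c)); rewrite -det1; ring.
set x := c%:~R / a%:R in nx dx; set y := s%:~R / b%:R in ny dy.
exists x; split; rewrite ?dx //.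
  rewrite /x divr_gt0 ?ltr0n ?ltr0z //=; last by rewrite /c; lia.
  by rewrite ler_pdivrMr ?ltr0n // mul1r -[a%:R]/(a%:Z%:~R) ler_int /c; lia.
have xy : farey_next Q x y by apply: adjacent_next; rewrite /det ?nx ?ny ?dx ?dy.
have xQ : (den x <= Q)%N by rewrite dx.
by rewrite /dens (farey_next_inj (nextfP xQ) xy) dx dy.
Qed.

Lemma card_fset_set_count (T : choiceType) (U : eqType) (A : set T)
    (s : seq U) (P : pred U) (f : T -> U) : finite_set A -> uniq s ->
  (forall x, A x -> f x \in s /\ P (f x)) ->
  (forall x y, A x -> A y -> f x = f y -> x = y) ->
  (forall y, y \in s -> P y -> exists2 x, A x & y = f x) ->
  #|` fset_set A| = count P s.
Proof.
move=> finA us fP fI fS.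
have AE x : (x \in fset_set A) -> A x by rewrite in_fset_set // inE.
have EA x : A x -> x \in fset_set A by rewrite in_fset_set // inE.
rewrite -(count_bij (s := enum_fset (fset_set A)) (P := predT) (f := f)) ?fset_uniq //.
- by move=> x /AE /fP.
- by move=> x y /AE Ax /AE Ay _ _; exact: fI.
- by move=> y ys Py; have [x Ax ->] := fS y ys Py; exists x => //; split; rewrite ?EA.
Qed.

Lemma mod2E n : (n = 0 %[mod 2]) <-> ~~ odd n.
Proof. by rewrite mod0n modn2; case: (odd n). Qed.

Lemma N_class_even_pairs Q : N_class Q 2 0 = even_pairs Q.
Proof.
rewrite /N_class /even_pairs; apply: (card_fset_set_count (f := dens Q)).
- exact: finite_farey_class.
- exact: tri_uniq.
- move=> x [/farey_extE xQ _ /mod2E ex].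
  have [xT xc] := dens_tri xQ; split=> //; rewrite xc /E_oddrun ex /=.
  rewrite /oddrun /= andbT /orb /=; move: xc => /= xc.
  apply: contraT => oy; suff : (2 %| gcdn (den x) (den (nextf Q x)))%N by rewrite (eqP xc).
  by rewrite dvdn_gcd !dvdn2 ex.
- move=> x x' [/farey_extE xQ x01 _] [/farey_extE xQ' xx01 _]; exact: dens_inj.
- move=> p pT /andP[pc /andP[ep _]]; have [x [xQ x01 xp]] := dens_surj pT pc.
  exists x => //; split=> //; first exact/farey_extE.
  by apply/mod2E; move: ep; rewrite -xp.
Qed.

Lemma farey_tuple_iter Q r (t : r.+2.-tuple rat) :
  (forall i, (i <= r)%N -> farey_next Q t`_i t`_i.+1) ->
  forall i, (i <= r.+1)%N -> t`_i = iter i (nextf Q) t`_0.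
Proof.
move=> tn; elim=> [//|i IH] ir /=; rewrite -IH ?(ltnW ir) //.
have ti := tn i ir; have [tQ _ _ _] := farey_nextP ti.
exact: farey_next_inj ti (nextfP tQ).
Qed.

Lemma oddrun_stepP Q r p :
  reflect (forall i, (1 <= i <= r)%N -> odd (orb Q p i)) (oddrun Q r (step Q p)).
Proof.
apply: (iffP allP) => [h [//|i] /andP[_ ir]|h i].
  by rewrite orbS; apply: h; rewrite mem_iota.
by rewrite mem_iota /= add0n -orbS => ir; apply: h.
Qed.

Lemma N_tuples_even_gaps Q r : N_tuples Q r 2 0 = even_gaps Q r.
Proof.
rewrite /N_tuples /even_gaps.
apply: (card_fset_set_count (f := fun t : r.+2.-tuple rat => dens Q t`_0)).
- exact: finite_farey_tuples.
- exact: tri_uniq.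
- move=> t [t01 tn /mod2E e0 /mod2E e1 oi].
  have [tQ _ _ _] := farey_nextP (tn 0 isT).
  have tE := farey_tuple_iter tn.
  have dE i : (i <= r.+1)%N -> den t`_i = orb Q (dens Q t`_0) i.
    by move=> ir; rewrite tE // den_iter.
  have [xT xc] := dens_tri tQ; split=> //; rewrite xc /E_oddrun e0 /= -dE // e1 andbT.
  apply/oddrun_stepP => i /andP[i0 ir]; rewrite -dE ?(leq_trans ir) //.
  by apply: contraT => /mod2E; have := oi i; rewrite i0 ir => /(_ isT).
- move=> t t' [t01 tn _ _ _] [tt01 tn' _ _ _] tt.
  have [tQ _ _ _] := farey_nextP (tn 0 isT); have [tQ' _ _ _] := farey_nextP (tn' 0 isT).
  have t0 := dens_inj tQ tQ' t01 tt01 tt.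
  apply: val_inj; apply: (@eq_from_nth _ 0); rewrite !size_tuple // => i ir.
  by rewrite (farey_tuple_iter tn) // (farey_tuple_iter tn') // t0.
- move=> p pT /and3P[pc /andP[ep op] er]; have [x [xQ x01 xp]] := dens_surj pT pc.
  pose t := [tuple of mkseq (fun i => iter i (nextf Q) x) r.+2].
  have tE i : (i <= r.+1)%N -> t`_i = iter i (nextf Q) x.
    by move=> ir; rewrite /t /= nth_mkseq.
  exists t; last by rewrite tE // xp.
  split; rewrite ?tE //.
  + by move=> i ir; rewrite !tE ?(leq_trans ir) //; apply: nextfP; have [] := dens_iter i xQ.
  + by apply/mod2E; move: ep; rewrite -xp.
  + by apply/mod2E; rewrite den_iter // xp.
  + move=> i /andP[i0 ir]; rewrite tE ?(leq_trans ir) // den_iter // xp => /mod2E.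
    by rewrite (oddrun_stepP _ _ _ op) // i0 ir.
Qed.

Local Open Scope nat_scope.

(** * Runs of odd denominators are mostly arithmetic progressions *)

(** The three numbers being odd, the quotient of [a + c] by [b] is even. *)
Lemma odd_triple X a b : (a, b) \in tri X -> odd a -> odd b ->
  odd (nxt X a b) ->
  [\/ a + nxt X a b = 2 * b, a + nxt X a b = 4 * b | 6 * b <= a + nxt X a b].
Proof.
move=> abT oa ob oc; have [_ /dvdnP[k kE]] := nxtP abT.
have : odd (k * b) = false by rewrite -kE oddD oa oc.
rewrite oddM ob andbT => ek; have kE2 := odd_double_half k.
move: kE; rewrite -kE2 ek add0n; move: (k./2) => m {k kE2 ek} kE.
have a0 : 0 < a by case: a oa {abT oc kE}.
case: m kE => [|[|[|m]]] kE; [lia|constructor 1; lia|constructor 2; lia|constructor 3].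
by rewrite kE leq_mul2r; apply/orP; right; lia.
Qed.

(** The arithmetic progression of [r] terms that starts with [a], [b] stays in
    (0, X] and its neighbours keep a sum greater than [X]. In the decreasing
    case, with last term y and difference -d, this is X < 2y + d, written
    without subtraction. *)
Definition odd_AP r X (p : nat * nat) :=
  [&& odd p.1, odd p.2 &
   if p.1 <= p.2 then p.1 + r.-1 * (p.2 - p.1) <= X
   else X + 2 * r.-1 * (p.1 - p.2) < 2 * p.1 + (p.1 - p.2)].

Lemma oddrun2 X p : p \in tri X -> oddrun X 2 p = odd_AP 2 X p.
Proof.
case: p => a b; rewrite mem_tri /oddrun /odd_AP /= andbT mul1n => abT.
have -> : orb X (a, b) 1 = b by [].
have -> : orb X (a, b) 0 = a by [].
case: (odd a); case: (odd b) => //=; case: (leqP a b) => ?; lia.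
Qed.

(** Peeling off the first term, as for [oddrunS]: the remaining terms form a
    progression, and so do the first three. *)
Lemma odd_APS r X a b : 2 <= r -> (a, b) \in tri X ->
  odd_AP r.+1 X (a, b) =
    [&& odd a, odd_AP r X (b, nxt X a b) & a + nxt X a b == 2 * b].
Proof.
move=> r2 abT; have [bcT _] := nxtP abT.
have nE c : (b, c) \in tri X -> a + c = 2 * b -> nxt X a b = c.
  by move=> cT e; apply: nxt_eq => //; rewrite e dvdn_mull.
have rE : r = (r - 2).+2 by lia.
move: abT bcT nE; set n := nxt X a b; rewrite /odd_AP /=.
move=> abT bcT nE; apply/idP/idP.
- move=> /and3P[oa ob].
  case: (leqP a b) => abl H.
    have nb : n = b + (b - a).
      by apply: nE; rewrite ?mem_tri; move: abT; rewrite mem_tri; nia.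
    rewrite oa ob nb /= oddD oddB // oa ob /= leq_addr.
    rewrite (_ : b + (b - a) - b = b - a); last by lia.
    by apply/andP; split; [nia|lia].
  have [k kE] : exists k, a = b + k by exists (a - b); lia.
  have kb : k < b by move: abT; rewrite mem_tri; nia.
  have nb : n = b - k.
    by apply: nE; rewrite ?mem_tri; move: abT; rewrite mem_tri; nia.
  have ek : odd k = false by move: oa; rewrite kE oddD ob; case: (odd k).
  have onk : odd (b - k) by rewrite oddB ?ob ?ek // ltnW.
  rewrite oa ob nb /= onk /=.
  case: (leqP b (b - k)) => ?; first by lia.
  by apply/andP; split; [nia|lia].
- move=> /and3P[oa /and3P[ob on H] /eqP e]; rewrite oa ob /=.
  move: H; case: (leqP b n) => bn H.
    by case: (leqP a b) => ?; [nia|lia].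
  case: (leqP a b) => ?; first by lia.
  by nia.
Qed.

(** In a run of five odd denominators the three inner ones are means of their
    neighbours: an inner [b] that is not satisfies [4 * b <= a + c], which
    forces [b] below the values allowed by the other terms. *)
Lemma odd_window x0 x1 x2 x3 x4 X :
  x0 <= X -> x1 <= X -> x2 <= X -> x3 <= X -> x4 <= X ->
  X < x0 + x1 -> X < x1 + x2 -> X < x2 + x3 -> X < x3 + x4 ->
  x0 + x2 = 2 * x1 \/ 4 * x1 <= x0 + x2 ->
  x1 + x3 = 2 * x2 \/ 4 * x2 <= x1 + x3 ->
  x2 + x4 = 2 * x3 \/ 4 * x3 <= x2 + x4 ->
  [/\ x0 + x2 = 2 * x1, x1 + x3 = 2 * x2 & x2 + x4 = 2 * x3].
Proof. by move=> *; split; lia. Qed.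

Lemma odd_triple_weak X a b : (a, b) \in tri X -> odd a -> odd b ->
  odd (nxt X a b) ->
  a + nxt X a b = 2 * b \/ 4 * b <= a + nxt X a b.
Proof. by move=> abT oa ob oc; case: (odd_triple abT oa ob oc); lia. Qed.

Lemma odd_run5 X a b : (a, b) \in tri X -> oddrun X 5 (a, b) ->
  let c := nxt X a b in let d := nxt X b c in
  [/\ a + c = 2 * b, b + d = 2 * c & c + nxt X c d = 2 * d].
Proof.
move=> abT; rewrite !oddrunS => /= /and5P[oa ob oc od].
set c := nxt X a b in oc od *; set d := nxt X b c in od *.
rewrite andbT; set e := nxt X c d => oe.
have [bcT _] := nxtP abT; rewrite -/c in bcT.
have [cdT _] := nxtP bcT; rewrite -/d in cdT.
have [deT _] := nxtP cdT; rewrite -/e in deT.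
have := odd_triple_weak abT oa ob oc; have := odd_triple_weak bcT ob oc od.
have := odd_triple_weak cdT oc od oe; rewrite -/c -/d -/e.
move: abT bcT cdT deT => /mem_triP[? ? ? ? ?] /mem_triP[? ? ? ? ?].
move=> /mem_triP[? ? ? ? ?] /mem_triP[? ? ? ? ?] ? ? ?.
exact: (@odd_window a b c d e X).
Qed.

Lemma oddrun_AP r X p : 5 <= r -> p \in tri X -> oddrun X r p = odd_AP r X p.
Proof.
case: r => [|[|[|[|[|r]]]]] // _; elim: r p => [|r IH] [a b] abT.
  rewrite odd_APS //; have [bcT _] := nxtP abT.
  rewrite odd_APS //; have [cdT _] := nxtP bcT.
  rewrite odd_APS //; have [deT _] := nxtP cdT.
  rewrite -oddrun2 //.
  apply/idP/idP => [H|]; last first.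
    by rewrite !oddrunS /= => /and3P[-> /and3P[-> /and3P[-> /and3P[-> -> _] _] _] _].
  have [/= e1 e2 e3] := odd_run5 abT H; rewrite e1 e2 e3 !eqxx !andbT.
  by move: H; rewrite !oddrunS /= !andbT.
have [bcT _] := nxtP abT.
rewrite odd_APS // oddrunS /= IH //; case: (boolP (odd a)) => //= oa.
case: (boolP (odd_AP _ _ _)) => //= H.
suff [-> _ _] : [/\ a + nxt X a b = 2 * b, b + nxt X b (nxt X a b) = 2 * nxt X a b &
    nxt X a b + nxt X (nxt X a b) (nxt X b (nxt X a b)) = 2 * nxt X b (nxt X a b)].
  by rewrite eqxx.
apply: odd_run5 => //.
have : oddrun X r.+4.+2 (a, b) by rewrite oddrunS /= oa IH.
rewrite /oddrun -[r.+4.+2]/(5 + r.+1) iotaD all_cat => /andP[-> _] //.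
Qed.

(** A run of four odd denominators may also have one inner denominator that is
    a quarter of the sum of its neighbours; two such ones exclude each other. *)
Lemma oddrun4 X a b : (a, b) \in tri X ->
  let c := nxt X a b in let d := nxt X b c in
  oddrun X 4 (a, b) =
   odd_AP 4 X (a, b) ||
   [&& odd a, odd b, odd c, odd d &
     (a + c == 4 * b) && (b + d == 2 * c) || (a + c == 2 * b) && (b + d == 4 * c)].
Proof.
move=> abT c d; have [bcT _] := nxtP abT; have [cdT _] := nxtP bcT.
rewrite odd_APS // odd_APS // -oddrun2 //; rewrite -/c -/d in bcT cdT *.
rewrite !oddrunS /= !andbT -/c -/d.
case: (boolP (odd a)) => //= oa; case: (boolP (odd b)) => //= ob.
case: (boolP (odd c)) => //= oc; case: (boolP (odd d)) => //= od.
have := odd_triple abT oa ob oc; have := odd_triple bcT ob oc od; rewrite -/c -/d.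
move: abT bcT cdT => /mem_triP[? ? ? ? ?] /mem_triP[? ? ? ? ?] /mem_triP[? ? ? ? ?].
by case=> ?; case=> ?; lia.
Qed.

(** * Counting lattice points *)

Lemma count_pairs (s t : seq nat) (P : pred (nat * nat)) :
  count P [seq (x, y) | x <- s, y <- t] =
  \sum_(x <- s) count (fun y => P (x, y)) t.
Proof.
rewrite count_flatten -map_comp sumnE big_map; apply: eq_bigr => x _ /=.
by rewrite count_map.
Qed.

Lemma mem_pairs (s t : seq nat) x y :
  ((x, y) \in [seq (x, y) | x <- s, y <- t]) = (x \in s) && (y \in t).
Proof.
apply/allpairsP/andP => [[[a b] /= [? ? [-> ->]]]|[xs yt]] //.
by exists (x, y).
Qed.

Lemma pairs_uniq (s t : seq nat) :
  uniq s -> uniq t -> uniq [seq (x, y) | x <- s, y <- t].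
Proof. by move=> us ut; apply: allpairs_uniq => // -[? ?] [? ?]. Qed.

Lemma count_split (T : Type) (Q P : pred T) s :
  count P s = count (fun x => P x && Q x) s + count (fun x => P x && ~~ Q x) s.
Proof. by elim: s => //= x s ->; case: (P x); case: (Q x) => /=; lia. Qed.

Lemma count_itv lo hi N :
  count (fun i => lo <= i < hi) (iota 0 N) = minn hi N - lo.
Proof. by elim: N => [|N IH]; rewrite ?minn0 // -addn1 iotaD count_cat IH /=; lia. Qed.

Lemma sum_progression_widen m X N : 0 < m -> X < N ->
  \sum_(0 <= e < N) (X - m * e) = \sum_(0 <= e < X.+1) (X - m * e).
Proof.
move=> m0 XN; rewrite (big_cat_nat _ (n := X.+1)) //=.
have -> : \sum_(X.+1 <= e < N) (X - m * e) = 0; last by rewrite addn0.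
rewrite big_nat_cond big1 // => e /andP[/andP[Xe _] _].
by apply/eqP; rewrite subn_eq0 (leq_trans (ltnW Xe)) // leq_pmull.
Qed.

(** The error is O(X) uniformly in [m]. As a function of [X] the sum satisfies
    s (X + m) = X + m + s X, hence an induction by steps of [m]. *)
Lemma sum_progression m X : 0 < m ->
  let s := \sum_(0 <= e < X.+1) (X - m * e) in
  X ^ 2 <= 2 * m * s <= X ^ 2 + 2 * m * X.
Proof.
move=> m0 /=; have [n] := ubnP X; elim: n X => // n IH X Xn.
case: (ltnP X m) => Xm.
  rewrite big_nat_recl // muln0 subn0 big1 ?addn0 => [|e _]; last by nia.
  by nia.
have {}IH := IH (X - m) ltac:(lia).
rewrite big_nat_recl // muln0 subn0.
rewrite (eq_bigr (fun e => (X - m) - m * e)); last by move=> e _; nia.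
rewrite sum_progression_widen //; last by lia.
set s := \sum_(0 <= e < _) _ in IH *; nia.
Qed.

(** ** Arithmetic progressions of odd numbers *)

(** The pair [(e, i)] stands for the progression of first term 2i+1 and
    difference 2e. *)
Definition APpoint r X (p : nat * nat) :=
  (X < 4 * p.2 + 2 + 2 * p.1) && (2 * p.2 + 1 + r.-1 * (2 * p.1) <= X).

Definition APbox s X := [seq (e, i) | e <- iota s X.+1, i <- iota 0 X.+1].

Lemma mem_APbox s X e i : ((e, i) \in APbox s X) = (s <= e < s + X.+1) && (i <= X).
Proof. by rewrite mem_pairs !mem_iota add0n ltnS. Qed.

Lemma oddP n : odd n -> exists i, n = 2 * i + 1.
Proof. by move=> on; exists n./2; lia. Qed.

(** Increasing and decreasing progressions; constant ones are counted with the
    former, hence the two boxes differ in the range of e. *)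
Lemma count_odd_AP r X : 2 <= r ->
  count (odd_AP r X) (tri X) =
    count (APpoint r X) (APbox 0 X) + count (APpoint r X) (APbox 1 X).
Proof.
case: r => [|[|r]] // _; rewrite (count_split (fun p => p.1 <= p.2)).
have box_uniq s : uniq (APbox s X) by rewrite pairs_uniq ?iota_uniq.
have tE e : 2 * e <= r.+1 * (2 * e) by rewrite leq_pmull.
congr (_ + _); apply/esym.
- apply: (count_bij (f := fun p => (2 * p.2 + 1, 2 * p.2 + 1 + 2 * p.1))).
  + exact: box_uniq.
  + exact: tri_uniq.
  + move=> [e i]; rewrite mem_APbox /APpoint /= mem_tri /odd_AP /= => _.
    rewrite (_ : 2 * i + 1 + 2 * e - (2 * i + 1) = 2 * e); last by lia.
    have -> : (2 * i + 1 <= 2 * i + 1 + 2 * e) = true by lia.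
    by have := tE e; move: (_ * (2 * e)) => h; lia.
  + by move=> [e i] [e' i'] _ _ _ _ /= [? ?]; congr (_, _); lia.
  + move=> [a b] abT; rewrite /odd_AP /= => /andP[/and3P[/oddP[i aE] /oddP[j bE]]].
    subst a b => + ab; rewrite ab => H.
    have [e je] : exists e, j = i + e by exists (j - i); lia.
    exists (e, i); last by congr (_, _) => /=; lia.
    rewrite mem_APbox /APpoint /=; move: H abT; rewrite mem_tri je.
    rewrite (_ : 2 * (i + e) + 1 - (2 * i + 1) = 2 * e); last by lia.
    by have := tE e; move: (_ * (2 * e)) => h; lia.
- apply: (count_bij (f := fun p =>
    (2 * p.2 + 1 + r.+1 * (2 * p.1), 2 * p.2 + 1 + r * (2 * p.1)))).
  + exact: box_uniq.
  + exact: tri_uniq.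
  + move=> [e i]; rewrite mem_APbox /APpoint /= mem_tri /odd_AP /= => ei.
    have rE : r.+1 * (2 * e) = 2 * e + r * (2 * e).
      by rewrite (mulSn r).
    have -> : 2 * i + 1 + r.+1 * (2 * e) - (2 * i + 1 + r * (2 * e)) = 2 * e.
      by rewrite rE; lia.
    rewrite -mulnA rE.
    set t := r * (2 * e).
    have -> : (2 * i + 1 + (2 * e + t) <= 2 * i + 1 + t) = false by lia.
    have : odd t = false by rewrite oddM oddM andbF.
    by lia.
  + move=> [e i] [e' i'] _ _ _ _ /= [].
    rewrite !mulSn => ? ?; have ee : e = e' by lia.
    by subst e'; congr (_, _); lia.
  + move=> [a b] abT; rewrite /odd_AP /= => /andP[/and3P[/oddP[i aE] /oddP[j bE]]].
    subst a b => + ab; rewrite (negbTE ab) => H.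
    have [e je] : exists e, i = j + e by exists (i - j); lia.
    move: H abT; rewrite mem_tri je.
    rewrite (_ : 2 * (j + e) + 1 - (2 * j + 1) = 2 * e); last by lia.
    rewrite -mulnA (mulSn r) => H abT.
    have tE' : r * (2 * e) = 2 * (r * e) by rewrite mulnCA.
    move: H; rewrite tE'; set t := r * e in tE' *; move=> H.
    exists (e, j - t); last by rewrite /= (mulSn r) tE' ; congr (_, _); lia.
    by rewrite mem_APbox /APpoint /= (mulSn r) tE'; lia.
Qed.

(** For given e the admissible i form an interval, whose length is linear in e. *)
Lemma count_APpoint_row r X e : 2 <= r ->
  let k := count (fun i => APpoint r X (e, i)) (iota 0 X.+1) in
  X - 2 * (2 * r - 3) * e <= 4 * k + 4 /\
  4 * k <= X - 2 * (2 * r - 3) * e + 4.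
Proof.
move=> r2 k; pose h := r.-1 * (2 * e).
rewrite /k (eq_count (a2 := fun i => (X + 2 - 2 * e) %/ 4 <= i < (X + 1 - h) %/ 2)).
  have -> : 2 * (2 * r - 3) * e = 2 * h - 2 * e by rewrite /h; nia.
  have : 2 * e <= h by rewrite /h leq_pmull //; lia.
  by rewrite count_itv; lia.
by move=> i; rewrite /APpoint /= -/h; lia.
Qed.

Lemma count_APbox r s X : 2 <= r -> s <= 1 ->
  let k := count (APpoint r X) (APbox s X) in
  let m := 2 * (2 * r - 3) in
  X ^ 2 <= m * (8 * k + 20 * X.+1) /\ m * (8 * k) <= X ^ 2 + m * (20 * X.+1).
Proof.
move=> r2 s1 k m; have m0 : 0 < m by rewrite /m; lia.
have [T1 T2] := andP (@sum_progression m X m0).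
set T := \sum_(_ <= e < _) _ in T1 T2.
have : T <= 4 * k + 5 * X.+1 /\ 4 * k <= T + 5 * X.+1; last by nia.
have TE : T = \sum_(0 <= e < s + X.+1) (X - m * e).
  by rewrite sum_progression_widen //; lia.
have TE2 : \sum_(s <= e < s + X.+1) (X - m * e) <= T <=
   X + \sum_(s <= e < s + X.+1) (X - m * e).
  rewrite TE; case: s s1 {TE k} => [|[|]] //= _; first by rewrite leqnn leq_addl.
  by rewrite [\sum_(0 <= e < _) _]big_ltn // muln0 subn0 leq_addl /= leqnn.
have kE : k = \sum_(s <= e < s + X.+1) count (fun i => APpoint r X (e, i)) (iota 0 X.+1).
  by rewrite /k count_pairs /index_iota addKn.
have c4 : \sum_(s <= e < s + X.+1) 4 = 4 * X.+1.
  by rewrite sum_nat_const_nat addKn mulnC.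
suff : \sum_(s <= e < s + X.+1) (X - m * e) <= 4 * k + 4 * X.+1 /\
   4 * k <= \sum_(s <= e < s + X.+1) (X - m * e) + 4 * X.+1 by lia.
rewrite kE -c4 big_distrr -!big_split /=; split; apply: leq_sum => e _;
by have [] := count_APpoint_row X e r2.
Qed.

Lemma count_odd_AP_asymp r X : 2 <= r ->
  let k := count (odd_AP r X) (tri X) in
  X ^ 2 <= (2 * r - 3) * (8 * k + 40 * X.+1) /\
  (2 * r - 3) * (8 * k) <= X ^ 2 + (2 * r - 3) * (40 * X.+1).
Proof.
move=> r2 /=; rewrite count_odd_AP //.
have := count_APbox (s := 0) X r2 isT; have := count_APbox (s := 1) X r2 isT.
by move=> /=; nia.
Qed.

(** ** Short runs *)

Lemma count_tri_row X (P : pred (nat * nat)) :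
  count P (tri X) =
  \sum_(a <- iota 1 X) count (fun b => (X < a + b) && P (a, b)) (iota 1 X).
Proof.
rewrite count_filter count_pairs; apply: eq_bigr => a _.
by apply: eq_count => b /=; rewrite andbC.
Qed.

Lemma count_tri_col X (P : pred (nat * nat)) :
  count P (tri X) =
  \sum_(b <- iota 1 X) count (fun a => (X < a + b) && P (a, b)) (iota 1 X).
Proof.
rewrite -(count_bij (s := tri X) (P := fun p => P (p.2, p.1))
  (f := fun p => (p.2, p.1))) ?tri_uniq //.
- rewrite count_tri_row; apply: eq_bigr => b _.
  by apply: eq_count => a /=; rewrite addnC.
- by move=> [a b] abT Pab /=; rewrite swap_tri.
- by move=> [a b] [c d] _ _ _ _ [-> ->].
- by move=> [a b] abT Pab; exists (b, a) => //; rewrite swap_tri.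
Qed.

Lemma iota1S N : iota 1 N.+1 = iota 1 N ++ [:: N.+1].
Proof. by rewrite -(addn1 N) iotaD add1n addn1. Qed.

Lemma count_itv1 lo hi N : 0 < lo ->
  count (fun i => lo <= i < hi) (iota 1 N) = minn hi N.+1 - lo.
Proof.
move=> lo0; elim: N => [|N IH]; first by rewrite /=; lia.
by rewrite iota1S count_cat IH /=; lia.
Qed.

Lemma count_odd_itv lo hi N : 0 < lo <= hi -> hi <= N.+1 ->
  count (fun i => odd i && (lo <= i < hi)) (iota 1 N) = hi./2 - lo./2.
Proof.
move=> lh hN.
have -> : hi./2 = (minn hi N.+1)./2 by rewrite (minn_idPl hN).
elim: N {hN} => [|N IH]; first by rewrite /=; lia.
by rewrite iota1S count_cat IH /=; lia.
Qed.

Lemma oddruns1_asymp X : X ^ 2 <= 4 * oddruns X 1 <= X.+1 ^ 2.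
Proof.
suff -> : oddruns X 1 = \sum_(1 <= a < X.+1) odd a * a.
  set s := \sum_(_ <= _ < _) _; have : 4 * s = (X + odd X) ^ 2; last first.
    by move=> ->; case: (odd X); nia.
  rewrite /s; elim: X {s} => [|X IH]; first by rewrite big_geq.
  rewrite big_nat_recr //= mulnDr {}IH.
  by case: (odd X); rewrite /= ?addn0 ?mul0n ?mul1n; nia.
rewrite /oddruns count_tri_row /index_iota subSS subn0; apply: eq_big_seq => a.
rewrite mem_iota add1n ltnS => aX.
have -> : odd a * a = count (fun b => odd a && (X.+1 - a <= b < X.+1)) (iota 1 X).
  case: (odd a) => /=; last by rewrite count_pred0.
  by rewrite count_itv1; lia.
apply: eq_in_count => b; rewrite mem_iota /oddrun /= andbT /orb /=.
by case: (odd a) => /=; lia.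
Qed.

(** ** Runs of length four *)

(** The points behind the runs of four odd denominators that are not
    progressions: such a run is, up to reversal, 3x-2e, x, x+2e, x+4e, and
    the first coordinate j is given by X - (x+4e) = 2j+p, where the parity
    [p] makes x odd. *)
Definition turn_point X (p : nat * nat) :=
  let v := 2 * p.1 + ~~ odd X in (6 * p.2 + 2 * v < X) && (2 * X <= 14 * p.2 + 3 * v).

Definition turn_box X := [seq (j, e) | j <- iota 0 X.+1, e <- iota 0 X.+1].

(** With v = 2j+p the admissible e form an interval of length (X-5v)/42. *)
Lemma count_turn X :
  X ^ 2 <= 840 * count (turn_point X) (turn_box X) + 2000 * X.+1 /\
  840 * count (turn_point X) (turn_box X) <= X ^ 2 + 2000 * X.+1.
Proof.
rewrite count_pairs; set p := nat_of_bool (~~ odd X).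
have p1 : p <= 1 by rewrite /p; case: (odd X).
have /andP[S1 S2] := @sum_progression 10 (X - 5 * p) isT.
have SE : \sum_(0 <= j < (X - 5 * p).+1) (X - 5 * p - 10 * j) =
          \sum_(0 <= j < X.+1) (X - 5 * p - 10 * j).
  by rewrite [RHS]sum_progression_widen //; lia.
rewrite SE in S1 S2.
set k := \sum_(j <- _) _; set s := \sum_(_ <= _ < _) _ in S1 S2.
suff : s <= 42 * k + 42 * X.+1 /\ 42 * k <= s + 42 * X.+1 by nia.
have kE : k = \sum_(0 <= j < X.+1) count (fun e => turn_point X (j, e)) (iota 0 X.+1).
  by rewrite /k /index_iota subn0.
have c4 : \sum_(0 <= e < X.+1) 42 = 42 * X.+1.
  by rewrite sum_nat_const_nat subn0 mulnC.
have row j :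
  X - 5 * p - 10 * j <=
    42 * count (fun e => turn_point X (j, e)) (iota 0 X.+1) + 42 /\
    42 * count (fun e => turn_point X (j, e)) (iota 0 X.+1) <= X - 5 * p - 10 * j + 42.
  pose v := 2 * j + p.
  rewrite (eq_count
    (a2 := fun e => (2 * X + 13 - 3 * v) %/ 14 <= e < (X + 5 - 2 * v) %/ 6)).
    by rewrite count_itv; lia.
  by move=> e; rewrite /turn_point /= -/p -/v; lia.
rewrite kE -c4 big_distrr -!big_split /=; split; apply: leq_sum => j _;
by have [] := row j.
Qed.

Definition turn_min X (p : nat * nat) := X - (2 * p.1 + ~~ odd X) - 4 * p.2.

Lemma turn_pointP X j e : turn_point X (j, e) ->
  let y := turn_min X (j, e) in
  [/\ odd y, y + 4 * e + (2 * j + ~~ odd X) = X, X < 2 * y + 2 * e &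
      3 * y <= X + 2 * e].
Proof.
rewrite /turn_point /turn_min /=; set p := nat_of_bool _ => /andP[c1 c2].
have [y yE] : exists y, X = y + 4 * e + (2 * j + p).
  by exists (X - (2 * j + p) - 4 * e); lia.
have -> : X - (2 * j + p) - 4 * e = y by lia.
by rewrite /p in c1 c2 yE *; split; lia.
Qed.

Lemma oddruns4_split X :
  oddruns X 4 = count (odd_AP 4 X) (tri X) + 2 * count (turn_point X) (turn_box X).
Proof.
pose odds X (p : nat * nat) := let c := nxt X p.1 p.2 in let d := nxt X p.2 c in
  [&& odd p.1, odd p.2, odd c & odd d].
pose turn2 p := let c := nxt X p.1 p.2 in let d := nxt X p.2 c in
  odds X p && ((p.1 + c == 4 * p.2) && (p.2 + d == 2 * c)).
pose turn3 p := let c := nxt X p.1 p.2 in let d := nxt X p.2 c in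
  odds X p && ((p.1 + c == 2 * p.2) && (p.2 + d == 4 * c)).
have tb_uniq : uniq (turn_box X) by rewrite pairs_uniq ?iota_uniq.
have -> : oddruns X 4 = count (odd_AP 4 X) (tri X) +
    (count turn2 (tri X) + count turn3 (tri X)).
  rewrite /oddruns (count_split (odd_AP 4 X)); congr (_ + _).
    apply: eq_in_count => -[a b] abT; rewrite oddrun4 //.
    by case: (odd_AP _ _ _); rewrite /= ?andbF.
  rewrite (count_split turn2); congr (_ + _); apply: eq_in_count => -[a b] abT.
  1,2: have [bcT _] := nxtP abT; have [cdT _] := nxtP bcT.
  1,2: rewrite oddrun4 // odd_APS // odd_APS // -oddrun2 // /turn2 /turn3 /odds /=.
  1,2: rewrite /oddrun /orb /=; move: (mem_triP abT) (mem_triP bcT) => [? _ ? _ _] [_ _ ? _ _].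
  1,2: move: bcT cdT; set c := nxt X a b; set d := nxt X b c => bcT cdT.
  1,2: rewrite !andbT; move: (mem_triP cdT) => [_ _ ? _ _].
  1,2: case: (odd a) (odd b) (odd c) (odd d) => -[] [] [] //=; lia.
congr (_ + _); rewrite mul2n -addnn; congr (_ + _); apply/esym.
- apply: (count_bij (f := fun p => (3 * turn_min X p - 2 * p.2, turn_min X p))).
  + exact: tb_uniq.
  + exact: tri_uniq.
  + move=> [j e] _ /turn_pointP /=; set y := turn_min _ _ => -[oy yX y1 y2].
    have [T1 [T2 T3]] : (3 * y - 2 * e, y) \in tri X /\ (y, y + 2 * e) \in tri X /\
        (y + 2 * e, y + 4 * e) \in tri X.
      by rewrite !mem_tri; lia.
    have n1 : nxt X (3 * y - 2 * e) y = y + 2 * e.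
      apply: nxt_eq => //; have -> : 3 * y - 2 * e + (y + 2 * e) = 4 * y by lia.
      exact: dvdn_mull.
    have n2 : nxt X y (y + 2 * e) = y + 4 * e.
      apply: nxt_eq => //; have -> : y + (y + 4 * e) = 2 * (y + 2 * e) by lia.
      exact: dvdn_mull.
    split=> //; rewrite /turn2 /odds /= n1 n2.
    by lia.
  + move=> [j e] [j' e'] _ _ /turn_pointP /= [_ + + _] /turn_pointP /= [_ + + _] [].
    set y := turn_min _ _; set y' := turn_min _ _ => ? ? ? ? ? ?.
    by congr (_, _); lia.
  + move=> [a b] abT; rewrite /turn2 /odds /=.
    have [bcT _] := nxtP abT; have [cdT _] := nxtP bcT.
    move: bcT cdT; set c := nxt X a b; set d := nxt X b c => bcT cdT.
    move=> /andP[/and4P[oa ob oc od] /andP[/eqP e1 /eqP e2]].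
    move: (mem_triP abT) (mem_triP bcT) (mem_triP cdT).
    move=> [? ? ? ? ?] [? ? ? ? ?] [? ? ? ? ?].
    have bc : b <= c by lia.
    exists ((X - d)./2, (c - b)./2); last by rewrite /turn_min /=; congr (_, _); lia.
    by split; [rewrite mem_pairs !mem_iota; lia|rewrite /turn_point /=; lia].
- apply: (count_bij (f := fun p => (turn_min X p + 4 * p.2, turn_min X p + 2 * p.2))).
  + exact: tb_uniq.
  + exact: tri_uniq.
  + move=> [j e] _ /turn_pointP /=; set y := turn_min _ _ => -[oy yX y1 y2].
    have [T1 [T2 T3]] : (y + 4 * e, y + 2 * e) \in tri X /\ (y + 2 * e, y) \in tri X /\
        (y, 3 * y - 2 * e) \in tri X.
      by rewrite !mem_tri; lia.
    have n1 : nxt X (y + 4 * e) (y + 2 * e) = y.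
      apply: nxt_eq => //; have -> : y + 4 * e + y = 2 * (y + 2 * e) by lia.
      exact: dvdn_mull.
    have n2 : nxt X (y + 2 * e) y = 3 * y - 2 * e.
      apply: nxt_eq => //; have -> : y + 2 * e + (3 * y - 2 * e) = 4 * y by lia.
      exact: dvdn_mull.
    split=> //; rewrite /turn3 /odds /= n1 n2.
    by lia.
  + move=> [j e] [j' e'] _ _ /turn_pointP /= [_ + + _] /turn_pointP /= [_ + + _] [].
    set y := turn_min _ _; set y' := turn_min _ _ => ? ? ? ? ? ?.
    by congr (_, _); lia.
  + move=> [a b] abT; rewrite /turn3 /odds /=.
    have [bcT _] := nxtP abT; have [cdT _] := nxtP bcT.
    move: bcT cdT; set c := nxt X a b; set d := nxt X b c => bcT cdT.
    move=> /andP[/and4P[oa ob oc od] /andP[/eqP e1 /eqP e2]].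
    move: (mem_triP abT) (mem_triP bcT) (mem_triP cdT).
    move=> [? ? ? ? ?] [? ? ? ? ?] [? ? ? ? ?].
    have bc : c <= b by lia.
    exists ((X - a)./2, (b - c)./2); last by rewrite /turn_min /=; congr (_, _); lia.
    by split; [rewrite mem_pairs !mem_iota; lia|rewrite /turn_point /=; lia].
Qed.

Lemma oddruns4_asymp X : 23 * X ^ 2 <= 840 * oddruns X 4 + 4500 * (2 * X.+1) /\
  840 * oddruns X 4 <= 23 * X ^ 2 + 4500 * (2 * X.+1).
Proof.
rewrite oddruns4_split; have := @count_odd_AP_asymp 4 X isT; have := count_turn X.
set k := count (turn_point X) _; set l := count (odd_AP 4 X) _.
by move: (X ^ 2) => Y; lia.
Qed.

(** ** Runs of length three *)

(** The distance from [X] to the multiples of [q]. *)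
Definition mdist X q := minn (X %% q) (q - X %% q).

Lemma modn_uniq n k q r : n = k * q + r -> r < q -> n %% q = r.
Proof. by move=> -> rq; rewrite modnMDl modn_small. Qed.

(** Both neighbours of a given odd [q] lie in the window (X - q, X] and have
    sum congruent to 0 modulo [q]; for both to be odd, one of them runs over
    the odd numbers of an interval of length 2 * [mdist X q]. *)
Lemma count_odd_neighbours X q : odd q -> q <= X ->
  let c := count (fun a => (X < a + q) && (odd a && odd (nxt X a q))) (iota 1 X) in
  c <= mdist X q + 1 /\ mdist X q <= c + 1.
Proof.
move=> oq qX; have q0 : 0 < q by apply: odd_gt0.
rewrite /mdist; set t := X %% q; set k := X %/ q.
have XE : X = k * q + t by apply: divn_eq.
have tq : t < q by rewrite ltn_mod.
have k0 : 0 < k by rewrite divn_gt0.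
case: (ltnP (2 * t) q) => tq2.
  rewrite (@eq_in_count _ _ (fun a => odd a && (X - 2 * t <= a < X.+1))).
    by rewrite count_odd_itv; lia.
  move=> a; rewrite mem_iota add1n ltnS => /andP[a0 aX].
  case: (boolP (odd a)) => oa; rewrite /= ?andbF //.
  case: (leqP (X + 1 - q) a) => qa; last by lia.
  case: (leqP (X - 2 * t) a) => ta.
    have -> : nxt X a q = X - (2 * t - (X - a)).
      by rewrite /nxt (@modn_uniq _ (2 * k) q (2 * t - (X - a))) //; nia.
    by lia.
  have -> : nxt X a q = X - (q + 2 * t - (X - a)).
    rewrite /nxt (@modn_uniq _ (2 * k - 1) q (q + 2 * t - (X - a))) //; last by lia.
    by rewrite mulnBl; nia.
  by lia.
rewrite (@eq_in_count _ _ (fun a => odd a && (X + 1 - q <= a < X + q - 2 * t))).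
  by rewrite count_odd_itv; lia.
move=> a; rewrite mem_iota add1n ltnS => /andP[a0 aX].
case: (boolP (odd a)) => oa; rewrite /= ?andbF //.
case: (leqP (X + 1 - q) a) => qa; last by lia.
case: (leqP (X + q - 2 * t) a) => ta.
  have -> : nxt X a q = X - (2 * t - q - (X - a)).
    rewrite /nxt (@modn_uniq _ (2 * k + 1) q (2 * t - q - (X - a))) //; last by lia.
    by rewrite mulnDl; nia.
  by lia.
have -> : nxt X a q = X - (2 * t - (X - a)).
  rewrite /nxt (@modn_uniq _ (2 * k) q (2 * t - (X - a))) //; last by lia.
  by nia.
by lia.
Qed.

Definition dsum X := \sum_(q <- iota 1 X | odd q) mdist X q.

Lemma oddruns3_dsum X : oddruns X 3 <= dsum X + X /\ dsum X <= oddruns X 3 + X.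
Proof.
rewrite /oddruns count_tri_col /dsum [\sum_(q <- _ | odd q) _]big_mkcond /=.
set A := \sum_(b <- _) count _ _; set B := \sum_(q <- _) _.
have s1 : \sum_(q <- iota 1 X) 1 = X by rewrite sum1_size size_iota.
suff : A <= B + \sum_(q <- iota 1 X) 1 /\ B <= A + \sum_(q <- iota 1 X) 1 by rewrite s1.
rewrite /A /B -!big_split /=; split; rewrite big_seq [leqRHS]big_seq; apply: leq_sum => q;
  rewrite mem_iota add1n ltnS => /andP[_ qX].
all: rewrite (@eq_count _ _ (fun a =>
  odd q && ((X < a + q) && (odd a && odd (nxt X a q))))); last first.
1,3: by move=> a; rewrite /oddrun /orb /= andbT; case: (odd q); rewrite /= ?andbF.
all: case: (boolP (odd q)) => oq /=; rewrite ?count_pred0 //.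
all: by have [] := count_odd_neighbours oq qX.
Qed.

(** * The sum of the distances to the multiples of odd numbers *)

Lemma mdist_le m X q : 0 < q -> mdist X q <= (X - m * q) + (m * q - X).
Proof.
move=> q0; rewrite /mdist; have XE := divn_eq X q; have := ltn_pmod X q0.
move: XE; set k := X %/ q; set t := X %% q => XE tq.
case: (leqP m k) => mk.
  have : m * q <= k * q by rewrite leq_mul2r mk orbT.
  by lia.
have : k.+1 * q <= m * q by rewrite leq_mul2r mk orbT.
by rewrite mulSn; lia.
Qed.

Lemma mdist_ex X q : 0 < q ->
  exists2 m, mdist X q = (X - m * q) + (m * q - X) & 2 * m * q <= 2 * X + q.
Proof.
move=> q0; rewrite /mdist; have XE := divn_eq X q; have := ltn_pmod X q0.
move: XE; set k := X %/ q; set t := X %% q => XE tq.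
case: (leqP (2 * t) q) => tq2; [exists k|exists k.+1]; rewrite -?mulnA ?mulSn; lia.
Qed.

Lemma mdist_small X q : 0 < q -> 2 * mdist X q <= q.
Proof. by move=> q0; rewrite /mdist; have := ltn_pmod X q0; lia. Qed.

Lemma mdist_leX X q : mdist X q <= X.
Proof. by rewrite /mdist (leq_trans (geq_minl _ _)) // leq_mod. Qed.

(** The multiple of [q] nearest to [X] is the m-th one as long as 2X/q lies
    between 2m-1 and 2m+1; this lemma and the next treat the two halves of such
    intervals, on which [mdist X q] is linear in [q]. *)
Lemma mdist_even m X q : 2 * m * q <= 2 * X <= (2 * m).+1 * q ->
  mdist X q = X - m * q.
Proof.
case: (posnP q) => [->|q0] H.
  by have := mdist_leX X 0; rewrite !muln0 in H *; lia.
have := mdist_le m X q0; have [m' -> _] := mdist_ex X q0.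
rewrite (mulSn _ q) -!mulnA in H; case: (ltngtP m m') => mm; last by subst m'; lia.
  by have : m.+1 * q <= m' * q by [rewrite leq_mul2r mm orbT]; rewrite mulSn; lia.
by have : m'.+1 * q <= m * q by [rewrite leq_mul2r mm orbT]; rewrite mulSn; lia.
Qed.

Lemma mdist_odd m X q : (2 * m).+1 * q <= 2 * X <= (2 * m).+2 * q ->
  mdist X q = m.+1 * q - X.
Proof.
case: (posnP q) => [->|q0] H.
  by have := mdist_leX X 0; rewrite !muln0 in H *; lia.
have := mdist_le m.+1 X q0; have [m' -> _] := mdist_ex X q0.
rewrite !(mulSn _ q) -!mulnA in H *; case: (ltngtP m.+1 m') => mm.
3: by subst m'; rewrite mulSn; lia.
  by have : m.+2 * q <= m' * q by [rewrite leq_mul2r mm orbT]; rewrite !mulSn; lia.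
by have : m'.+1 * q <= m.+1 * q by [rewrite leq_mul2r mm orbT]; rewrite !mulSn; lia.
Qed.

(** As a function of [q], [mdist X q] is piecewise linear with breakpoints
    2X/j; here the breakpoint 2X/j lies within distance 1 of the odd number
    2i+1. *)
Definition breakpoint X i j := j * (2 * i) < 2 * X < j * (2 * i + 2).

Lemma sum_odd_block n i : \sum_(n * i <= l < n * i.+1) (2 * l + 1) = n ^ 2 * (2 * i + 1).
Proof.
have E N : \sum_(0 <= l < N) (2 * l + 1) = N ^ 2.
  elim: N => [|N IH]; first by rewrite big_geq.
  by rewrite big_nat_recr //= IH; nia.
have := E (n * i.+1); rewrite (big_cat_nat _ (n := n * i)) //= ?E; first by nia.
by rewrite leq_mul2l leqnSn orbT.
Qed.

(** The odd numbers 2l+1 in this range are those at distance less than [n] from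
    n * (2i+1); there are [n] of them, placed symmetrically. *)
Definition dblock n X i := \sum_(n * i <= l < n * i.+1) mdist (n * X) (2 * l + 1).

Lemma block_size n i c : \sum_(n * i <= l < n * i.+1) c = n * c.
Proof. by rewrite sum_nat_const_nat mulnS addnK. Qed.

(** Away from the breakpoints the values over the block around [n * (2i+1)]
    are in arithmetic progression, and their sum is exactly [n] times the
    middle one. *)
Lemma dblock_linear n X i : (forall j, ~~ breakpoint X i j) ->
  dblock n X i = n ^ 2 * mdist X (2 * i + 1).
Proof.
move=> nb; pose j := (2 * X) %/ (2 * i + 2).
have jq : j * (2 * i + 2) <= 2 * X by apply: leq_trunc_div.
have jq' : 2 * X <= j.+1 * (2 * i).
  have := nb j.+1; rewrite /breakpoint.
  have -> : 2 * X < j.+1 * (2 * i + 2) by apply: ltn_ceil; rewrite addn2.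
  by rewrite andbT -leqNgt.
have jE l : n * i <= l < n * i.+1 ->
    j * (2 * l + 1) <= 2 * (n * X) <= j.+1 * (2 * l + 1).
  move=> /andP[l1 l2].
  have h1 : j * (2 * l + 1) <= j * (n * (2 * i + 2)) by rewrite leq_mul2l; apply/orP; right; nia.
  have h2 : j.+1 * (n * (2 * i)) <= j.+1 * (2 * l + 1) by rewrite leq_mul2l; apply/orP; right; nia.
  by apply/andP; split; nia.
have jE1 : j * (2 * i + 1) <= 2 * X <= j.+1 * (2 * i + 1) by nia.
have [m [jm|jm]] : exists m, j = 2 * m \/ j = (2 * m).+1.
  by exists j./2; have := odd_double_half j; case: (odd j); lia.
- rewrite (@mdist_even m); last by rewrite -jm.
  rewrite /dblock; set s := \sum_(_ <= _ < _) _.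
  suff : s + m * (n ^ 2 * (2 * i + 1)) = n * (n * X).
    by move: jE1; rewrite jm mulnBr; nia.
  rewrite -sum_odd_block big_distrr -(block_size n i (n * X)) -big_split /=.
  apply: eq_big_nat => l lb; rewrite (@mdist_even m) -?jm ?jE //.
  by have := jE l lb; rewrite jm; nia.
- rewrite (@mdist_odd m); last by rewrite -jm.
  rewrite /dblock; set s := \sum_(_ <= _ < _) _.
  suff : s + n * (n * X) = m.+1 * (n ^ 2 * (2 * i + 1)).
    by move: jE1; rewrite jm mulnBr; nia.
  rewrite -sum_odd_block big_distrr -(block_size n i (n * X)) -big_split /=.
  apply: eq_big_nat => l lb; rewrite (@mdist_odd m) -?jm ?jE //.
  by have := jE l lb; rewrite jm; nia.
Qed.

(** A trivial bound, for the 2i+1 below the square root of X. *)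
Lemma dblock_small n X i :
  dblock n X i <= n ^ 2 * (2 * i + 1) /\
  n ^ 2 * mdist X (2 * i + 1) <= n ^ 2 * (2 * i + 1).
Proof.
have h q : mdist X (2 * q + 1) <= 2 * q + 1.
  by have := @mdist_small X (2 * q + 1); lia.
split; last by rewrite leq_mul2l h orbT.
rewrite -sum_odd_block; apply: leq_sum => l _.
by have := @mdist_small (n * X) (2 * l + 1); lia.
Qed.

(** At a breakpoint 2X/j the slope of [mdist X] is at most 2j in absolute
    value. *)
Lemma dblock_break n X i j : 0 < n -> 0 < i -> 2 * i + 1 <= X -> breakpoint X i j ->
  dblock n X i <= n ^ 2 * mdist X (2 * i + 1) + n ^ 2 * (2 * j) /\
  n ^ 2 * mdist X (2 * i + 1) <= dblock n X i + n ^ 2 * (2 * j).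
Proof.
move=> n0 i0 qX /andP[_ bX]; set q := 2 * i + 1.
have q0 : 0 < q by rewrite /q; lia.
have small m : m * q <= 2 * X -> m <= 2 * j.
  move=> mq; rewrite leqNgt; apply/negP => jm.
  have : (2 * j) * q <= m * q by rewrite leq_mul2r ltnW ?orbT.
  have : j * (2 * i + 2) <= j * (2 * q) by rewrite leq_mul2l; apply/orP; right; rewrite /q; lia.
  by rewrite mulnCA mulnA; lia.
have n2 c : n ^ 2 * c = n * (n * c) by rewrite -mulnA mulnA.
rewrite !n2 -(block_size n i (n * mdist X q)).
rewrite -(block_size n i (n * (2 * j))) -!big_split /dblock /=.
split; rewrite big_nat_cond [leqRHS]big_nat_cond; apply: leq_sum => l;
  move=> /andP[/andP[l1 l2] _]; have l0 : 0 < 2 * l + 1 by lia.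
- have [m mE mq] := mdist_ex X q0; rewrite mE.
  have mj : m <= 2 * j by apply: small; lia.
  apply: leq_trans (mdist_le m _ l0) _.
  have h1 : m * (2 * l + 1) <= m * (n * q + n) by rewrite leq_mul2l; apply/orP; right; rewrite /q; nia.
  have h2 : m * (n * q) <= m * (2 * l + 1 + n) by rewrite leq_mul2l; apply/orP; right; rewrite /q; nia.
  have h3 : m * n <= n * (2 * j) by rewrite mulnC leq_mul2l mj orbT.
  have e1 : n * (X - m * q + (m * q - X)) = n * X - m * (n * q) + (m * (n * q) - n * X).
    by rewrite mulnDr !mulnBr ![n * (m * q)]mulnCA.
  rewrite e1; rewrite !mulnDr in h1 h2 *; lia.
- have [m mE mq] := mdist_ex (n * X) l0; rewrite mE.
  have mj : m <= 2 * j.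
    apply: small; case: m mq {mE} => // m mq.
    have lb : 2 * (n * q) <= 3 * (2 * l + 1) by rewrite /q; nia.
    have : (2 * m).+1 * (2 * (n * q)) <= (2 * m).+1 * (3 * (2 * l + 1)).
      by rewrite leq_mul2l lb orbT.
    have : (2 * m).+1 * (2 * l + 1) <= 2 * (n * X) by rewrite mulSn; lia.
    move=> h1 h2; have : n * ((2 * m).+1 * q) <= n * (3 * X) by nia.
    by rewrite leq_pmul2l // mulSn; lia.
  apply: leq_trans (_ : n * (X - m * q + (m * q - X)) <= _).
    by rewrite leq_mul2l mdist_le ?orbT.
  have h1 : m * (2 * l + 1) <= m * (n * q + n) by rewrite leq_mul2l; apply/orP; right; rewrite /q; nia.
  have h2 : m * (n * q) <= m * (2 * l + 1 + n) by rewrite leq_mul2l; apply/orP; right; rewrite /q; nia.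
  have h3 : m * n <= n * (2 * j) by rewrite mulnC leq_mul2l mj orbT.
  have e1 : n * (X - m * q + (m * q - X)) = n * X - m * (n * q) + (m * (n * q) - n * X).
    by rewrite mulnDr !mulnBr ![n * (m * q)]mulnCA.
  rewrite e1; rewrite !mulnDr in h1 h2 *; lia.
Qed.

Lemma sum_odds N (F : nat -> nat) :
  \sum_(q <- iota 1 N | odd q) F q = \sum_(0 <= i < uphalf N) F (2 * i + 1).
Proof.
elim: N => [|N IH]; first by rewrite big_nil big_geq.
rewrite iota1S big_cat /= IH [\sum_(q <- [:: _] | _) _]big_mkcond big_seq1 /=.
have := odd_double_half N; rewrite uphalf_half; case: (odd N) => /= NE.
  by rewrite addn0.
rewrite big_nat_recr //=; congr (_ + F _); lia.
Qed.

(** The blocks exhaust the odd numbers up to n * X, and for odd X overshoot by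
    at most [n] terms. *)
Lemma dsum_blocks n X : 0 < n ->
  let D := \sum_(0 <= i < uphalf X) dblock n X i in
  dsum (n * X) <= D <= dsum (n * X) + n ^ 2 * X.
Proof.
move=> n0 /=; set D := \sum_(0 <= i < _) _; pose F l := mdist (n * X) (2 * l + 1).
have DE : D = \sum_(0 <= l < n * uphalf X) F l.
  rewrite /D; elim: (uphalf X) => [|N IH]; first by rewrite muln0 !big_geq.
  rewrite big_nat_recr //= IH [in RHS](big_cat_nat _ (n := n * N)) //=.
  by rewrite leq_mul2l leqnSn orbT.
have [le1 le2] : uphalf (n * X) <= n * uphalf X /\
    n * uphalf X - uphalf (n * X) <= n.
  have [h [->|->]] : exists h, X = 2 * h \/ X = 2 * h + 1 by exists X./2; lia.
    have -> : uphalf (2 * h) = h by lia.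
    by rewrite mulnCA; lia.
  have -> : uphalf (2 * h + 1) = h.+1 by lia.
  by rewrite mulnDr mulnCA muln1 mulnS; lia.
have -> : dsum (n * X) = \sum_(0 <= l < uphalf (n * X)) F l by rewrite /dsum sum_odds.
rewrite DE (big_cat_nat _ (n := uphalf (n * X)) (p := n * uphalf X)) //=.
rewrite leq_addr leq_add2l /=.
apply: leq_trans (_ : \sum_(uphalf (n * X) <= l < n * uphalf X) n * X <= _).
  by apply: leq_sum => l _; apply: mdist_leX.
by rewrite sum_nat_const_nat -mulnn -mulnA leq_mul2r le2 orbT.
Qed.

Lemma sqrt_ex X : exists s, s ^ 2 <= X < s.+1 ^ 2.
Proof.
elim: X => [|X [s /andP[s1 s2]]]; first by exists 0.
by case: (ltnP X.+1 (s.+1 ^ 2)) => h; [exists s|exists s.+1]; nia.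
Qed.

(** For every [j] there is at most one odd number within distance 1 of 2X/j;
    those beyond the square root of [X] have [j] of order at most the square
    root, and together they contribute O(X). *)
Lemma dblock_error n X s : 0 < n -> s ^ 2 <= X < s.+1 ^ 2 ->
  exists2 e : nat -> nat,
    forall i, 2 * i + 1 <= X ->
      dblock n X i <= n ^ 2 * mdist X (2 * i + 1) + n ^ 2 * e i /\
      n ^ 2 * mdist X (2 * i + 1) <= dblock n X i + n ^ 2 * e i &
    \sum_(0 <= i < uphalf X) e i <= 129 * X.
Proof.
move=> n0 /andP[sX Xs].
pose e1 i := if 2 * i + 1 <= s then s else 0.
pose e2 i := \sum_(0 <= j < 8 * s) breakpoint X i j * (2 * j).
exists (fun i => e1 i + e2 i).
- move=> i iX; case: (leqP (2 * i + 1) s) => si.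
    have [h1 h2] := dblock_small n X i.
    have : n ^ 2 * (2 * i + 1) <= n ^ 2 * (e1 i + e2 i).
      by rewrite leq_mul2l /e1 si; apply/orP; right; lia.
    by lia.
  have [/existsP[[j /= jX]] bj|nb] := boolP [exists j : 'I_(2 * X).+1, breakpoint X i j].
    have js : j < 8 * s.
      move: bj => /andP[bj _]; rewrite ltnNge; apply/negP => sj.
      have : (8 * s) * s <= j * (2 * i) by apply: leq_mul => //; lia.
      by case: s sX Xs si {e1 e2} sj => [|s]; nia.
    have je : 2 * j <= e1 i + e2 i.
      apply: leq_trans (leq_addl _ _); rewrite /e2 (bigD1_seq j) ?iota_uniq //=.
        by rewrite bj mul1n leq_addr.
      by rewrite mem_index_iota.
    case: (posnP i) => i0; first by move: bj; rewrite /breakpoint i0; nia.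
    have [h1 h2] := dblock_break n0 i0 iX bj.
    have : n ^ 2 * (2 * j) <= n ^ 2 * (e1 i + e2 i) by rewrite leq_mul2l je orbT.
    by lia.
  rewrite dblock_linear; first by lia.
  move=> j; apply/negP => bj; case: (leqP j (2 * X)) => jX.
    by move/existsP: nb; apply; exists (Ordinal (jX : j < (2 * X).+1)).
  move: bj => /andP[+ _]; case: (posnP i) => i0; last by nia.
  (* i = 0 forces s = 0, hence X = 0 *)
  by have s0 : s = 0 by [move: si; rewrite i0; lia]; move: Xs; rewrite s0; lia.
rewrite big_split /=.
have s1 : \sum_(0 <= i < uphalf X) e1 i <= s ^ 2.
  have : \sum_(0 <= i < uphalf X) e1 i <= minn (uphalf X) s * s; last by nia.
  elim: (uphalf X) => [|U IH]; first by rewrite big_geq.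
  rewrite big_nat_recr //= /e1; case: (leqP (2 * U + 1) s) => sU.
    have -> : minn U.+1 s = (minn U s).+1 by lia.
    by rewrite mulSn addnC leq_add2l.
  by rewrite addn0 (leq_trans IH) // leq_mul2r; apply/orP; right; lia.
have s2 : \sum_(0 <= i < uphalf X) e2 i <= 128 * s ^ 2.
  rewrite /e2 exchange_big /=.
  apply: leq_trans (_ : \sum_(0 <= j < 8 * s) 16 * s <= _); last first.
    by rewrite sum_nat_const_nat subn0; nia.
  rewrite big_nat_cond [leqRHS]big_nat_cond; apply: leq_sum => j /andP[/andP[_ js] _].
  apply: leq_trans (_ : 2 * j <= _); last by lia.
  have [/hasP[i iU bi]|nb] := boolP (has (fun i => breakpoint X i j) (index_iota 0 (uphalf X))).
    rewrite (bigD1_seq i) ?iota_uniq //= bi mul1n big1 ?addn0 // => i' ii'.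
    case: (boolP (breakpoint X i' j)) => // /andP[b1 b2].
    move: bi ii' => /andP[b3 b4] /eqP; case.
    by case: (ltngtP i' i) => // ?; nia.
  rewrite big_seq big1 // => i iU.
  by move/hasPn: nb => /(_ i iU) /negbTE ->.
by nia.
Qed.

(** Comparing [dsum (n * X)] with [n ^ 2 * dsum X] in both ways of writing
    [n * X] shows that [dsum X / X ^ 2] is a Cauchy sequence. *)
Lemma dsum_scale n X : 0 < n ->
  dsum (n * X) <= n ^ 2 * (dsum X + 130 * X) /\
  n ^ 2 * dsum X <= dsum (n * X) + n ^ 2 * (130 * X).
Proof.
move=> n0; have /andP[D1 D2] := dsum_blocks X n0.
have [s sX] := sqrt_ex X; have [e eP eS] := dblock_error n0 sX.
have := sum_odds X (fun q => mdist X q); rewrite -/(dsum X) => ->.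
have [B1 B2] : \sum_(0 <= i < uphalf X) dblock n X i <=
     \sum_(0 <= i < uphalf X) (n ^ 2 * mdist X (2 * i + 1) + n ^ 2 * e i) /\
   \sum_(0 <= i < uphalf X) n ^ 2 * mdist X (2 * i + 1) <=
     \sum_(0 <= i < uphalf X) (dblock n X i + n ^ 2 * e i).
  split; rewrite big_nat_cond [leqRHS]big_nat_cond; apply: leq_sum => i;
    move=> /andP[/andP[_ iX] _];
    have iX' : 2 * i + 1 <= X by move: iX; rewrite uphalf_half; lia.
    by have [] := eP i iX'.
  by have [] := eP i iX'.
move: B1 B2; rewrite !big_split /= -!big_distrr /=; nia.
Qed.

(** * Removing the coprimality condition *)

Definition mobius (n : nat) : int :=
  (if all (fun p => logn p n == 1) (primes n) then (-1) ^+ size (primes n) else 0)%R.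

Lemma mobius_le1 n : (`|mobius n| <= 1)%R.
Proof. by rewrite /mobius; case: ifP; rewrite ?normr0 // normrX normrN1 expr1n. Qed.

Lemma mobiusM p d : prime p -> 0 < d -> ~~ (p %| d) ->
  mobius (p * d) = (- mobius d)%R.
Proof.
move=> pp d0 pd; have p0 := prime_gt0 pp.
have pE : perm_eq (primes (p * d)) (p :: primes d).
  apply: uniq_perm; rewrite ?primes_uniq //= ?primes_uniq ?andbT.
    by rewrite mem_primes (negbTE pd) !andbF.
  by move=> q; rewrite primesM // primes_prime // !inE.
rewrite /mobius (perm_all _ pE) (perm_size pE) /= lognM // logn_prime // eqxx.
rewrite (lognE p d) (negbTE pd) !andbF addn0 eqxx /=.
rewrite (@eq_in_all _ _ (fun q => logn q d == 1)) => [|q qd].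
  by case: ifP; rewrite ?oppr0 // exprS mulN1r.
rewrite lognM // logn_prime //; case: (q =P p) => [qp|//].
by move: qd; rewrite qp mem_primes (negbTE pd) !andbF.
Qed.

Lemma mobius_sq p d : prime p -> 0 < d -> p %| d -> mobius (p * d) = 0%R.
Proof.
move=> pp d0 pd; have p0 := prime_gt0 pp; rewrite /mobius.
case: ifP => // /allP /(_ p); rewrite primesM // primes_prime // mem_head.
rewrite lognM // logn_prime // eqxx => /(_ isT).
by rewrite lognE pp d0 pd.
Qed.

Lemma sum_mobius n : 0 < n -> (\sum_(e <- divisors n) mobius e = (n == 1)%:R)%R.
Proof.
move=> n0; case: (n =P 1) => [->|/eqP n1]; first by rewrite big_seq1.
pose p := pdiv n; have pp : prime p by apply: pdiv_prime; rewrite ltn_neqAle eq_sym n1.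
have pn : p %| n by apply: pdiv_dvd.
have p0 := prime_gt0 pp.
rewrite (bigID (fun e => p %| e)) /= (bigID (fun e => p ^ 2 %| e)) /=.
(* the divisors divisible by p ^ 2 contribute 0 *)
rewrite big_seq_cond big1 ?add0r => [|e]; last first.
  move=> /andP[en /andP[_ /dvdnP[k eE]]]; rewrite {}eE in en *.
  move: en; rewrite -dvdn_divisors // => /(dvdn_gt0 n0).
  rewrite muln_gt0 => /andP[k0 _].
  by rewrite mulnC -mulnn -mulnA mobius_sq ?muln_gt0 ?p0 ?dvdn_mulr.
rewrite -big_filter -[X in (_ + X)%R]big_filter.
set s := [seq e <- _ | ~~ _].
(* the other multiples of p are the p * d with d prime to p, of opposite sign *)
rewrite (perm_big (map (muln p) s)) /=; last first.
  apply: uniq_perm; rewrite ?filter_uniq ?divisors_uniq //.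
    rewrite map_inj_in_uniq ?filter_uniq ?divisors_uniq // => x y _ _ /eqP.
    by rewrite eqn_pmul2l // => /eqP.
  move=> e; rewrite mem_filter -dvdn_divisors //; apply/andP/mapP.
    move=> [/andP[/dvdnP[d ->] nd] dn]; exists d; rewrite 1?mulnC //.
    rewrite mem_filter -dvdn_divisors // (dvdn_trans _ dn) ?dvdn_mulr // andbT.
    by apply: contra nd => /dvdnP[k ->]; rewrite -mulnn -mulnA dvdn_mull.
  move=> [d]; rewrite mem_filter -dvdn_divisors // => /andP[pd dn] ->.
  rewrite dvdn_mulr // -mulnn dvdn_pmul2l // pd Gauss_dvd ?pn ?dn //.
  by rewrite prime_coprime.
rewrite big_map -big_split big_seq big1 // => d.
rewrite mem_filter -dvdn_divisors // => /andP[pd dn] /=.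
by rewrite mobiusM ?addNr ?(dvdn_gt0 n0 dn).
Qed.

Lemma sum_mobius_gcd X g : 0 < g <= X ->
  (\sum_(1 <= e < X.+1 | (e %| g)%N) mobius e = (g == 1)%:R)%R.
Proof.
move=> /andP[g0 gX]; rewrite -sum_mobius // -big_filter; apply: perm_big.
apply: uniq_perm; rewrite ?filter_uniq ?iota_uniq ?divisors_uniq // => e.
rewrite mem_filter -dvdn_divisors // mem_index_iota ltnS.
case: (boolP (e %| g)) => //= eg.
by rewrite (dvdn_gt0 g0 eg) (leq_trans (dvdn_leq g0 eg)).
Qed.

Lemma coprime_oddruns_mobius X r : 0 < r ->
  (coprime_oddruns X r)%:Z%R =
  (\sum_(1 <= e < X.+1 | odd e) mobius e * (oddruns (X %/ e)%N r)%:Z)%R.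
Proof.
move=> r0.
have cE (P : pred (nat * nat)) : (count P (tri X))%:Z%R = (\sum_(p <- tri X) (P p)%:Z)%R.
  rewrite -sum1_count big_mkcond /= (big_morph Posz PoszD (erefl _)).
  by apply: eq_bigr => p _; case: (P p).
rewrite /coprime_oddruns cE.
transitivity (\sum_(p <- tri X) \sum_(1 <= e < X.+1)
    mobius e * ([&& e %| p.1, e %| p.2 & oddrun X r p]%N)%:Z)%R.
  rewrite big_seq [RHS]big_seq; apply: eq_bigr => -[a b] /mem_triP[a0 aX b0 _ _] /=.
  have gX : 0 < gcdn a b <= X by rewrite gcdn_gt0 a0 (leq_trans _ aX) // dvdn_leq ?dvdn_gcdl.
  case: (oddrun X r (a, b)); rewrite ?andbT ?andbF; last first.
    by rewrite big1 // => e _; rewrite !andbF mulr0.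
  rewrite /coprime -natz -(sum_mobius_gcd gX) big_mkcond /=; apply: eq_bigr => e _.
  by rewrite dvdn_gcd ?andbT; case: ifP; rewrite ?mulr1 ?mulr0.
rewrite exchange_big /= [RHS]big_mkcond /=; rewrite !big_nat; apply: eq_bigr => e /andP[e0 eX].
rewrite -big_distrr -cE /=; case: ifP => oe; first by rewrite oddruns_scale.
by rewrite oddruns_scale_even ?oe ?mulr0.
Qed.

Local Open Scope classical_set_scope.
Local Open Scope ring_scope.

(** * Asymptotics of the lattice counts *)

(** By [dsum_scale], u m = dsum m / m^2 and u n both differ from u (m n) by
    at most 130/m and 130/n; so every u n + 130/n bounds every u m - 130/m, and
    the limit is the supremum of the latter. *)
Lemma dsum_asymp (R : realType) :
  exists l : R, forall n, `|(dsum n)%:R - l * n%:R ^+ 2| <= 130 * n%:R.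
Proof.
pose u m : R := (dsum m)%:R / m%:R ^+ 2.
have uP m n : (0 < m)%N -> (0 < n)%N -> u n - 130 / n%:R <= u m + 130 / m%:R.
  move=> m0 n0; have [h1 _] := dsum_scale m n0; have [_ h2] := dsum_scale n m0.
  have m0' : 0 < m%:R :> R by rewrite ltr0n.
  have n0' : 0 < n%:R :> R by rewrite ltr0n.
  have : (m ^ 2 * dsum n <= n ^ 2 * (dsum m + 130 * m) + m ^ 2 * (130 * n))%N.
    by rewrite (leq_trans h2) // mulnC leq_add2r.
  rewrite -(ler_nat R) !(natrD, natrM, natrX) => h.
  rewrite -subr_ge0.
  have -> : u m + 130 / m%:R - (u n - 130 / n%:R) =
    (n%:R ^+ 2 * ((dsum m)%:R + 130 * m%:R) + m%:R ^+ 2 * (130 * n%:R)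
     - m%:R ^+ 2 * (dsum n)%:R) / (m%:R ^+ 2 * n%:R ^+ 2).
    by rewrite /u; field; rewrite ?gt_eqF.
  by rewrite divr_ge0 ?subr_ge0 // mulr_ge0 ?exprn_ge0 ?ltW.
pose A := [set u n - 130 / n%:R | n in [set n | (0 < n)%N]].
have A0 : A !=set0 by exists (u 1%N - 130 / 1%:R); exists 1%N.
have Aub m : (0 < m)%N -> ubound A (u m + 130 / m%:R).
  by move=> m0 _ [n /= n0 <-]; exact: uP.
exists (sup A) => n; case: (posnP n) => [->|n0].
  by rewrite /dsum big_nil expr2 !mulr0 subrr normr0.
have n0' : 0 < n%:R :> R by rewrite ltr0n.
have h1 : sup A <= u n + 130 / n%:R by apply: ge_sup => //; exact: Aub.
have h2 : u n - 130 / n%:R <= sup A.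
  by apply: ub_le_sup; [exists (u n + 130 / n%:R); exact: Aub|exists n].
have dE : (dsum n)%:R = u n * n%:R ^+ 2 by rewrite /u divfK // expf_neq0 // gt_eqF.
rewrite dE -mulrBl normrM (ger0_norm (exprn_ge0 2 (ler0n R n))) expr2 mulrA.
rewrite (ler_pM2r n0') -ler_pdivlMr //.
by rewrite ler_norml; lra.
Qed.

Lemma oddruns_X0 r : oddruns 0 r = 0%N. Proof. by []. Qed.

Lemma AP_real (R : realType) r X : (2 <= r)%N ->
  `|(count (odd_AP r X) (tri X))%:R - (2 * r%:R - 3)^-1 * X%:R ^+ 2 / 8| <=
    5 * (X.+1)%:R :> R.
Proof.
move=> r2; have [h1 h2] := count_odd_AP_asymp X r2.
set k := count _ _ in h1 h2 *.
have mE : ((2 * r - 3)%N)%:R = 2 * r%:R - 3 :> R by rewrite natrB ?natrM //; lia.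
have m0 : 0 < 2 * r%:R - 3 :> R by rewrite -mE ltr0n; lia.
move: h1 h2; rewrite -!(ler_nat R) !(natrD, natrM, natrX) mE => h1 h2.
have e1 : X%:R ^+ 2 / (2 * r%:R - 3) <= 8 * k%:R + 40 * (X.+1)%:R :> R.
  by rewrite ler_pdivrMr // mulrC.
have e2 : 8 * k%:R - 40 * (X.+1)%:R <= X%:R ^+ 2 / (2 * r%:R - 3) :> R.
  by rewrite ler_pdivlMr // mulrC mulrBr; lra.
by rewrite [_^-1 * _]mulrC ler_norml; lra.
Qed.

(** The limit of 8 * oddruns X r / X^2, where [l] is the constant of
    [dsum_asymp]. *)
Definition runlim (R : realType) (l : R) (r : nat) : R :=
  if r == 1%N then 2 else if r == 3%N then 8 * l else
  if r == 4%N then 23 / 105 else (2 * r%:R - 3)^-1.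

Lemma oddruns_asymp (R : realType) (l : R) :
  (forall n, `|(dsum n)%:R - l * n%:R ^+ 2| <= 130 * n%:R) ->
  forall r X, (0 < r)%N ->
    `|(oddruns X r)%:R - runlim l r * X%:R ^+ 2 / 8| <= 200 * X%:R.
Proof.
move=> lP r X r0; case: (posnP X) => [->|X0].
  by rewrite oddruns_X0 expr2 !mulr0 mul0r subrr normr0.
have X1 : 1 <= X%:R :> R by rewrite ler1n.
have XS : (X.+1)%:R = X%:R + 1 :> R by rewrite -natr1.
rewrite /runlim; case: eqP => [->|r1].
  have := oddruns1_asymp X; rewrite -!(ler_nat R) natrM !natrX XS => /andP[h1 h2].
  by rewrite ler_norml; nra.
case: eqP => [->|r3].
  have [h1 h2] := oddruns3_dsum X; move: h1 h2; rewrite -!(ler_nat R) !natrD => h1 h2.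
  by have := lP X; rewrite !ler_norml; lra.
case: eqP => [->|r4].
  have := oddruns4_asymp X; rewrite -!(ler_nat R) !(natrD, natrM, natrX) XS => -[h1 h2].
  by rewrite ler_norml; lra.
have [r2 VE] : (2 <= r)%N /\ oddruns X r = count (odd_AP r X) (tri X).
  split; first by lia.
  apply: eq_in_count => p pT; case: (r =P 2%N) => [->|r2]; first exact: oddrun2.
  by apply: oddrun_AP => //; lia.
rewrite VE; apply: le_trans (AP_real R X r2) _; rewrite XS; lra.
Qed.

Lemma runlim_le (R : realType) (l : R) r : (0 < r)%N -> `|runlim l r| <= 2 + 8 * `|l|.
Proof.
move=> r0; have l0 := normr_ge0 l; rewrite /runlim.
case: eqP => [_|r1]; first by rewrite ger0_norm; lra.
case: eqP => [_|r3]; first by rewrite normrM ger0_norm; lra.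
case: eqP => [_|r4]; first by rewrite ger0_norm; lra.
have : 1 <= 2 * r%:R - 3 :> R.
  have : (2 <= r)%N by lia.
  by rewrite -(ler_nat R); lra.
move=> m1; have m0 : 0 < 2 * r%:R - 3 :> R by lra.
rewrite ger0_norm ?invr_ge0 ?ltW //.
have : (2 * r%:R - 3)^-1 <= 1 :> R by rewrite invf_le1.
by lra.
Qed.

(** ** Two sums over the divisor variable *)

Lemma harmonic_le (R : realType) n : (0 < n)%N ->
  \sum_(1 <= e < n.+1) (e%:R)^-1 <= 1 + ln n%:R :> R.
Proof.
case: n => // n _; elim: n => [|n IH]; first by rewrite big_nat1 ln1 invr1 addr0.
rewrite big_nat_recr //=; set s := \sum_(_ <= _ < _) _ in IH *.
have n0 : 0 < n.+1%:R :> R by rewrite ltr0n.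
have n1 : 0 < n.+2%:R :> R by rewrite ltr0n.
have : ln (n.+1%:R / n.+2%:R) <= - (n.+2%:R)^-1 :> R.
  have -> : n.+1%:R / n.+2%:R = 1 + - (n.+2%:R)^-1 :> R.
    by rewrite -[n.+2]addn1 natrD; field; rewrite -natr1 in n1; rewrite gt_eqF.
  by apply: le_ln1Dx; rewrite ltrN2 invf_lt1 // ltr1n.
rewrite ln_div ?posrE //; move: IH.
move: (ln n.+1%:R) (ln n.+2%:R) (n.+2%:R^-1) => x y z; lra.
Qed.

(** For odd e, 1/e^2 <= (1/(e-1) - 1/(e+1)) / 2 telescopes over the odd numbers;
    rounding n up to an even number makes the bound inductive. *)
Lemma inv_sq_odd_le (R : realType) n : (0 < n)%N ->
  \sum_(2 <= e < n.+1 | odd e) (e%:R ^+ 2)^-1 <= 4^-1 - (2 * (n + odd n)%:R)^-1 :> R.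
Proof.
elim: n => // m IH _; have [->|m0] := posnP m.
  by rewrite big_geq //= addn1 -natrM subrr.
have m0' : 0 < m%:R :> R by rewrite ltr0n.
rewrite big_mkcond big_nat_recr // -big_mkcond oddS.
move: (IH m0); set s := \sum_(_ <= _ < _ | _) _; case: (odd m) => /= sE.
  by rewrite addr0 (le_trans sE) // addn1 addn0.
rewrite addn0 in sE; rewrite addn1 -[m.+2%:R]natr1 -[m.+1%:R]natr1.
apply: le_trans (lerD sE (lexx _)) _; rewrite -subr_ge0.
set x : R := m%:R in m0' *.
have -> : 4^-1 - (2 * (x + 1 + 1))^-1 - (4^-1 - (2 * x)^-1 + ((x + 1) ^+ 2)^-1) =
  (x * (x + 2) * (x + 1) ^+ 2)^-1.
  by field; rewrite !gt_eqF //; lra.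
by rewrite invr_ge0 !mulr_ge0 ?exprn_ge0 //; lra.
Qed.

(** ** From all pairs to coprime pairs *)

Definition mobius_sum (R : realType) (Q : nat) (W : nat -> R) : R :=
  \sum_(1 <= e < Q.+1 | odd e) (mobius e)%:~R * W (Q %/ e)%N.

Lemma coprime_oddruns_real (R : realType) Q r : (0 < r)%N ->
  (coprime_oddruns Q r)%:R = mobius_sum Q (fun Y => (oddruns Y r)%:R) :> R.
Proof.
move=> r0; have := congr1 (fun z : int => z%:~R : R) (coprime_oddruns_mobius Q r0).
rewrite /= -pmulrn => ->; rewrite rmorph_sum /=; apply: eq_bigr => e _.
by rewrite rmorphM /= -pmulrn.
Qed.

Lemma even_pairs_real (R : realType) Q :
  (even_pairs Q)%:R = mobius_sum Q (fun Y => (oddruns Y 1)%:R - (oddruns Y 2)%:R) :> R.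
Proof.
have [e1 l1] := count_E_oddrun Q 1; rewrite /even_pairs e1 natrB // !coprime_oddruns_real //.
by rewrite /mobius_sum -sumrB; apply: eq_bigr => e _; rewrite mulrBr.
Qed.

Lemma even_gaps_real (R : realType) Q r : (0 < r)%N ->
  (even_gaps Q r)%:R =
  mobius_sum Q (fun Y => (oddruns Y r)%:R - 2 * (oddruns Y r.+1)%:R + (oddruns Y r.+2)%:R) :> R.
Proof.
move=> r0; have := congr1 (fun n => n%:R : R) (count_EOE Q r).
rewrite !natrD => e.
have -> : (even_gaps Q r)%:R =
  (coprime_oddruns Q r)%:R - 2 * (coprime_oddruns Q r.+1)%:R +
    (coprime_oddruns Q r.+2)%:R :> R by lra.
rewrite !coprime_oddruns_real // /mobius_sum mulr_sumr -sumrB -big_split /=.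
by apply: eq_bigr => i _; rewrite mulrDr mulrBr; congr (_ - _ + _); rewrite mulrCA.
Qed.

Lemma divn_ler (R : realType) Q e : (0 < e)%N -> (Q %/ e)%:R <= Q%:R * (e%:R)^-1 :> R.
Proof. by move=> e0; rewrite ler_pdivlMr ?ltr0n // -natrM ler_nat leq_trunc_div. Qed.

Lemma mobius_term (R : realType) (x : R) e : `|(mobius e)%:~R * x| <= `|x|.
Proof.
rewrite normrM ler_piMl // -intr_norm -[1]/(1%:~R) ler_int; exact: mobius_le1.
Qed.

(** A bound linear in the order costs one harmonic sum. *)
Lemma mobius_sum_le (R : realType) Q (W : nat -> R) K : (0 < Q)%N -> 0 <= K ->
  (forall Y, `|W Y| <= K * Y%:R) ->
  `|mobius_sum Q W| <= K * (Q%:R * (1 + ln Q%:R)).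
Proof.
move=> Q0 K0 WK; rewrite /mobius_sum (le_trans (ler_norm_sum _ _ _)) //.
apply: (@le_trans _ _ (\sum_(1 <= e < Q.+1) K * (Q%:R * (e%:R)^-1))).
  rewrite big_mkcond /= !big_nat; apply: ler_sum => e /andP[e0 _].
  case: ifP => _; last by rewrite !mulr_ge0 ?invr_ge0 ?ler0n.
  rewrite (le_trans (mobius_term _ _)) // (le_trans (WK _)) //.
  by rewrite ler_wpM2l // divn_ler.
by rewrite -mulr_sumr -mulr_sumr !ler_wpM2l ?ler0n // harmonic_le.
Qed.

Definition nulim (R : realType) (l : R) (r : nat) : R :=
  runlim l r - 2 * runlim l r.+1 + runlim l r.+2.

Lemma runlim2 (R : realType) (l : R) : runlim l 2 = 1.
Proof. by rewrite /runlim /=; have -> : 2 * 2%:R - 3 = 1 :> R by [lra]; rewrite invr1. Qed.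

(** [nulim l r] is the ratio of the main terms, so in the difference they cancel
    before the summation over divisors, and what is left is O(Y) in each
    order Y. *)
Lemma even_gaps_asymp (R : realType) (l : R) :
  (forall n, `|(dsum n)%:R - l * n%:R ^+ 2| <= 130 * n%:R) ->
  exists2 K : R, 0 <= K & forall r Q, (0 < r)%N -> (0 < Q)%N ->
   `|(even_gaps Q r)%:R - nulim l r * (even_pairs Q)%:R| <= K * (Q%:R * (1 + ln Q%:R)).
Proof.
move=> lP; pose B : R := 2 + 8 * `|l|; pose K := 800 + 4 * B * 400.
have B0 : 0 <= B by rewrite /B; have := normr_ge0 l; lra.
have K0 : 0 <= K by rewrite /K; lra.
exists K => // r Q r0 Q0.
rewrite even_gaps_real // even_pairs_real /mobius_sum mulr_sumr -sumrB.
rewrite (eq_bigr (fun e => (mobius e)%:~R *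
  (((oddruns (Q %/ e) r)%:R - 2 * (oddruns (Q %/ e) r.+1)%:R + (oddruns (Q %/ e) r.+2)%:R) -
   nulim l r * ((oddruns (Q %/ e) 1)%:R - (oddruns (Q %/ e) 2)%:R)))); last first.
  by move=> e _; ring.
apply: (@mobius_sum_le R Q (fun Y =>
   ((oddruns Y r)%:R - 2 * (oddruns Y r.+1)%:R + (oddruns Y r.+2)%:R) -
   nulim l r * ((oddruns Y 1)%:R - (oddruns Y 2)%:R)) K) => // Y.
have v1 : runlim l 1 = 2 by [].
have v2 := runlim2 l.
have nuB : `|nulim l r| <= 4 * B.
  have := @runlim_le R l r.+1 isT.
  have := @runlim_le R l r.+2 isT; have := @runlim_le R l r r0.
  by rewrite /nulim !ler_norml -/B; lra.
have a0 := oddruns_asymp lP Y r0; have a1 := @oddruns_asymp R l lP r.+1 Y isT.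
have a2 := @oddruns_asymp R l lP r.+2 Y isT.
have b1 := @oddruns_asymp R l lP 1 Y isT; have b2 := @oddruns_asymp R l lP 2 Y isT.
rewrite v1 in b1; rewrite v2 in b2.
set x : R := Y%:R in a0 a1 a2 b1 b2 *; have x0 : 0 <= x by rewrite /x.
have b3 : `|(oddruns Y 1)%:R - (oddruns Y 2)%:R - x ^+ 2 / 8| <= 400 * x.
  by move: b1 b2; rewrite !ler_norml; lra.
have b4 : `|nulim l r * ((oddruns Y 1)%:R - (oddruns Y 2)%:R - x ^+ 2 / 8)| <= 4 * B * (400 * x).
  by rewrite normrM ler_pM.
rewrite mulrBr {2}/nulim in b4.
set t := nulim l r * _ in b4 *.
rewrite /K [(800 + _) * x]mulrDl -[4 * B * 400 * x]mulrA; move: a0 a1 a2 b4.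
move: (runlim l r) (runlim l r.+1) (runlim l r.+2) => p q s.
have -> : (p - 2 * q + s) * (x ^+ 2 / 8) =
  p * x ^+ 2 / 8 - 2 * (q * x ^+ 2 / 8) + s * x ^+ 2 / 8 by lra.
by rewrite !ler_norml; lra.
Qed.

(** The divisor 1 contributes the main term Q^2/8, and the divisors e >= 3 at
    most the quarter of it, by [inv_sq_odd_le]. *)
Lemma even_pairs_ge (R : realType) Q : (0 < Q)%N ->
  3 / 32 * Q%:R ^+ 2 - 400 * (Q%:R * (1 + ln Q%:R)) <= (even_pairs Q)%:R :> R.
Proof.
move=> Q0; have [l lP] := dsum_asymp R.
pose W (Y : nat) : R := (oddruns Y 1)%:R - (oddruns Y 2)%:R.
have WE Y : `|W Y - Y%:R ^+ 2 / 8| <= 400 * Y%:R.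
  have := @oddruns_asymp R l lP 1 Y isT; have := @oddruns_asymp R l lP 2 Y isT.
  have -> : runlim l 1 = 2 by [].
  rewrite runlim2.
  by rewrite /W !ler_norml; lra.
pose q : R := Q%:R.
have t1 e : (0 < e)%N -> `|(mobius e)%:~R * W (Q %/ e)%N| <=
    q ^+ 2 / 8 * (e%:R ^+ 2)^-1 + 400 * (q * (e%:R)^-1).
  move=> e0; rewrite (le_trans (mobius_term _ _)) //.
  have h1 := WE (Q %/ e)%N; have h2 := @divn_ler R Q e e0.
  have h3 : (Q %/ e)%:R ^+ 2 <= q ^+ 2 * (e%:R ^+ 2)^-1.
    by rewrite -exprVn -exprMn lerXn2r ?nnegrE ?mulr_ge0 ?invr_ge0 ?ler0n.
  have h4 : 0 <= (Q %/ e)%:R ^+ 2 :> R by rewrite exprn_ge0.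
  move: h1 h2 h3 h4; rewrite -/q; move: (Q %/ e)%N => Y.
  by rewrite !ler_norml; lra.
rewrite even_pairs_real /mobius_sum big_ltn_cond //=.
have -> : (mobius 1)%:~R = 1 :> R by [].
rewrite mul1r divn1 -/(W Q).
set s := \sum_(_ <= _ < _ | _) _.
have hs : `|s| <= q ^+ 2 / 8 * 4^-1 + 400 * (q * (1 + ln q) - q).
  rewrite /s (le_trans (ler_norm_sum _ _ _)) //.
  apply: (@le_trans _ _ (\sum_(2 <= e < Q.+1 | odd e)
     (q ^+ 2 / 8 * (e%:R ^+ 2)^-1 + 400 * (q * (e%:R)^-1)))).
    rewrite big_nat_cond [leRHS]big_nat_cond; apply: ler_sum => e /andP[/andP[e2 _] _].
    by apply: t1; lia.
  rewrite big_split /= -mulr_sumr lerD //.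
    rewrite ler_wpM2l ?mulr_ge0 ?exprn_ge0 ?invr_ge0 ?ler0n //.
    rewrite (le_trans (inv_sq_odd_le R Q0)) // gerBl invr_ge0 mulr_ge0 ?ler0n //.
  rewrite -!mulr_sumr -[X in _ - X](mulr1 q) -mulrBr ler_wpM2l ?ler0n // ler_wpM2l ?ler0n //.
  have := @harmonic_le R Q Q0; rewrite big_ltn // invr1 -/q => h.
  apply: (@le_trans _ _ (\sum_(2 <= e < Q.+1) (e%:R)^-1)); last by lra.
  rewrite big_mkcond; by apply: ler_sum => e _; case: ifP.
have := WE Q; rewrite -/q; move: hs.
by rewrite !ler_norml; move: (q * (1 + ln q)) => z; lra.
Qed.

(** * The limit and the rate of convergence *)

Lemma ln_le_sqrt (R : realType) (x : R) : 0 < x -> ln x <= 2 * Num.sqrt x.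
Proof.
move=> x0; rewrite -{1}(sqr_sqrtr (ltW x0)).
have s0 : 0 < Num.sqrt x by rewrite sqrtr_gt0.
rewrite lnXn // mulr2n; have := ln_sublinear s0; lra.
Qed.

(** The set of admissible Q and the constant are the same for all [r]. *)
Lemma nuQ_rate (R : realType) (l : R) :
  (forall n, `|(dsum n)%:R - l * n%:R ^+ 2| <= 130 * n%:R) ->
  exists2 C : R, 0 <= C & \forall Q \near \oo, forall r, (0 < r)%N ->
    `|nuQ R Q r 2 0 - nulim l r| <= C * (ln Q%:R / Q%:R).
Proof.
move=> lP; have [K K0 KP] := even_gaps_asymp lP.
exists (32 * K); first by rewrite mulr_ge0.
near=> Q => r r0.
have Q1 : (0 < Q)%N by near: Q; exact: nbhs_infty_gt.
have Qe : expR 1 <= Q%:R :> R by near: Q; exact: nbhs_infty_ger.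
(* every s >= 170 ^ 2 satisfies 400 * (1 + 2 * s) <= s ^ 2 / 32; for s the square
   root of Q this bounds the error term in even_pairs_ge by a third of the main
   term *)
have Qs : (170 * 170) ^+ 2 <= Q%:R :> R by near: Q; exact: nbhs_infty_ger.
set q : R := Q%:R in Qe Qs *.
have q0 : 0 < q by rewrite /q ltr0n.
have ln1q : 1 <= ln q.
  by rewrite -[leLHS]expRK ler_ln ?posrE ?expR_gt0.
have s1 : 170 * 170 <= Num.sqrt q.
  by rewrite -[leLHS]ger0_norm // -sqrtr_sqr ler_sqrt // ltW.
have evQ : q ^+ 2 / 16 <= (even_pairs Q)%:R.
  apply: le_trans (even_pairs_ge R Q1); rewrite -/q.
  have lnq := ln_le_sqrt q0; have sq := sqr_sqrtr (ltW q0).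
  have : 400 * (1 + ln q) <= q / 32.
    have : 170 * 170 * Num.sqrt q <= q.
      by rewrite -{2}sq expr2 ler_wpM2r // sqrtr_ge0.
    by move: lnq s1; move: (Num.sqrt q) (ln q) => s y; lra.
  move=> h; have : q * (400 * (1 + ln q)) <= q * (q / 32) by rewrite ler_wpM2l // ltW.
  by rewrite expr2; move: (ln q) => y; lra.
have q2 : 0 < q ^+ 2 / 16 by rewrite divr_gt0 ?exprn_gt0.
have ev0 : 0 < (even_pairs Q)%:R :> R by apply: lt_le_trans evQ.
rewrite /nuQ N_tuples_even_gaps N_class_even_pairs.
have -> : (even_gaps Q r)%:R / (even_pairs Q)%:R - nulim l r =
    ((even_gaps Q r)%:R - nulim l r * (even_pairs Q)%:R) / (even_pairs Q)%:R.
  by rewrite mulrBl mulfK // gt_eqF.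
rewrite normrM normfV (gtr0_norm ev0) ler_pdivrMr //.
apply: le_trans (KP r Q r0 Q1) _; rewrite -/q -!mulrA.
rewrite [32 * _]mulrCA ler_wpM2l //.
apply: (@le_trans _ _ (q * (2 * ln q))); first by rewrite (ler_wpM2l (ltW q0)); lra.
have -> : q * (2 * ln q) = 32 * (ln q * (q^-1 * (q ^+ 2 / 16))).
  by field; rewrite gt_eqF.
have l0 : 0 <= ln q by lra.
rewrite ler_wpM2l // (ler_wpM2l l0) // ler_wpM2l // invr_ge0; exact: ltW.
Unshelve. all: by end_near. Qed.

Lemma nuQ_cvg (R : realType) (l : R) :
  (forall n, `|(dsum n)%:R - l * n%:R ^+ 2| <= 130 * n%:R) ->
  forall r, (0 < r)%N -> nuQ R Q r 2 0 @[Q --> \oo] --> nulim l r.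
Proof.
move=> lP r r0; have [C C0 CP] := nuQ_rate lP.
apply/cvgrPdist_le => e e0; near=> Q.
have Q1 : (0 < Q)%N by near: Q; exact: nbhs_infty_gt.
have Qe : (2 * C / e) ^+ 2 <= Q%:R by near: Q; exact: nbhs_infty_ger.
have h : `|nuQ R Q r 2 0 - nulim l r| <= C * (ln Q%:R / Q%:R).
  by move: r r0; near: Q.
rewrite distrC (le_trans h) //; set q : R := Q%:R in Qe *.
have q0 : 0 < q by rewrite /q ltr0n.
have s0 : 0 < Num.sqrt q by rewrite sqrtr_gt0.
have s1 : 2 * C / e <= Num.sqrt q.
  rewrite -[leLHS]ger0_norm; last by rewrite divr_ge0 ?mulr_ge0 // ltW.
  by rewrite -sqrtr_sqr ler_sqrt // ltW.
have h2 : C * (ln q / q) <= 2 * C / Num.sqrt q.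
  rewrite -{2}(sqr_sqrtr (ltW q0)).
  have -> : 2 * C / Num.sqrt q = C * (2 * Num.sqrt q / Num.sqrt q ^+ 2).
    by field; rewrite gt_eqF.
  by rewrite ler_wpM2l // ler_wpM2r ?ln_le_sqrt // invr_ge0 exprn_ge0 // ltW.
apply: le_trans h2 _; rewrite ler_pdivrMr //.
by move: s1; rewrite ler_pdivrMr // [_ * e]mulrC.
Unshelve. all: by end_near. Qed.

Lemma nulim4 (R : realType) (l : R) : nulim l 4 = 2 / 45.
Proof.
rewrite /nulim /runlim /=.
have -> : 2 * 5%:R - 3 = 7 :> R by lra.
have -> : 2 * 6%:R - 3 = 9 :> R by lra.
by lra.
Qed.

Lemma nulim_ge5 (R : realType) (l : R) r : (5 <= r)%N -> nulim l r =
  8 / ((2 * r%:R - 3) * (2 * r%:R - 1) * (2 * r%:R + 1)).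
Proof.
move=> r5.
have vE s : (5 <= s)%N -> runlim l s = (2 * s%:R - 3)^-1.
  by case: s => [|[|[|[|[|s]]]]].
have e1 : r.+1%:R = r%:R + 1 :> R by rewrite -natr1.
have e2 : r.+2%:R = r%:R + 1 + 1 :> R by rewrite -!natr1.
rewrite /nulim (vE r r5) (vE r.+1 (leqW r5)) (vE r.+2 (leqW (leqW r5))) e1 e2.
have : 5 <= r%:R :> R by rewrite (ler_nat R 5 r).
by move=> h; field; rewrite !gt_eqF //; lra.
Qed.

Theorem theorem2 (R : realType) :
  [/\ (forall r : nat, (1 <= r)%N -> cvg (nuQ R Q r 2 0 @[Q --> \oo])),
      (exists C : R, forall r : nat -> nat,
         (forall Q, (1 <= r Q)%N) ->
         (fun Q => (r Q)%:R : R) =o_\oo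
           (fun Q => (Q%:R / ln Q%:R) `^ (1 / 3%:R) : R) ->
         \forall Q \near \oo,
           `| nuQ R Q (r Q) 2 0 - nu R (r Q) 2 0 | <= C * (ln Q%:R / Q%:R)),
      nu R 4 2 0 = 2%:R / 45%:R &
      forall r : nat, (5 <= r)%N ->
        nu R r 2 0 =
          8%:R / ((2%:R * r%:R - 3%:R) * (2%:R * r%:R - 1) * (2%:R * r%:R + 1))].
Proof.
have [l lP] := dsum_asymp R.
have nuE r : (0 < r)%N -> nu R r 2 0 = nulim l r.
  by move=> r0; apply/cvg_lim => //; exact: nuQ_cvg.
split.
- by move=> r r0; apply/cvg_ex; exists (nulim l r); exact: nuQ_cvg.
- have [C C0 CP] := nuQ_rate lP; exists C => r r0 _.
  by apply: filterS CP => Q h; rewrite nuE //; exact: h.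
- by rewrite nuE // nulim4.
- by move=> r r5; rewrite nuE ?nulim_ge5 //; apply: leq_trans r5.
Qed.
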